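(* Let $\Omega$ be a locally compact Hausdorff space with countable base, let $\sigma\in\mathcal{M}^+(\Omega)$ and $0<q<1$. Suppose $G\colon\Omega\times\Omega\to[0,+\infty]$ is a lower semicontinuous, quasi-symmetric kernel which satisfies the weak maximum principle. Consider the statements: (1) There exists a positive constant $\varkappa=\varkappa(\sigma,G)$ such that $\|\mathbf{G}\nu\|_{L^q(\Omega,\sigma)}\le\varkappa\,\|\nu\|$ for all $\nu\in\mathcal{M}^+(\Omega)$. (2) There exists $u\in L^q(\Omega,\sigma)$ such that $u\ge\mathbf{G}(u^q\sigma)$ and $0<u<+\infty$ $d\sigma$-a.e. in $\Omega$. (3) There exists $u\in L^q(\Omega,\sigma)$ such that $u=\mathbf{G}(u^q\sigma)$ and $0<u<+\infty$ $d\sigma$-a.e. in $\Omega$. Then (1) and (2) are equivalent; and if in addition $G$ is non-degenerate with respect to $\sigma$, then (1), (2) and (3) are all equivalent.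
   Context: $\mathcal{M}^+(\Omega)$ is the class of nonnegative, locally finite Borel (Radon) measures on $\Omega$; $\|\nu\|=\nu(\Omega)$; $S_\nu$ is the support of $\nu$. For $\nu\in\mathcal{M}^+(\Omega)$, $\mathbf{G}\nu(x)=\int_\Omega G(x,y)\,d\nu(y)$, and $\mathbf{G}(u^q\sigma)(x)=\int_\Omega G(x,y)u(y)^q\,d\sigma(y)$. $\|f\|_{L^q(\Omega,\sigma)}=(\int_\Omega|f|^q\,d\sigma)^{1/q}$. $G$ is quasi-symmetric if there is a constant $a>0$ with $a^{-1}G(y,x)\le G(x,y)\le a\,G(y,x)$ for all $x,y\in\Omega$. $G$ satisfies the weak maximum principle (with constant $h\ge1$) if, for every constant $M>0$ and every $\nu\in\mathcal{M}^+(\Omega)$, the inequality $\mathbf{G}\nu(x)\le M$ for all $x\in S_\nu$ implies $\mathbf{G}\nu(x)\le hM$ for all $x\in\Omega$. $G$ is degenerate with respect to $\sigma$ if there is a set $A\subset\Omega$ with $\sigma(A)>0$ such that, for every $y\in A$, $G(\cdot,y)=0$ $d\sigma$-a.e.; otherwise $G$ is non-degenerate with respect to $\sigma$. *)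

(* Defs.v *)
From mathcomp Require Export all_boot all_order all_algebra.
From mathcomp Require Export all_classical all_reals all_analysis measurable_realfun.

Set Implicit Arguments.
Unset Strict Implicit.
Unset Printing Implicit Defensive.
Import Order.TTheory GRing.Theory Num.Theory.
Import numFieldNormedType.Exports.

Local Open Scope classical_set_scope.
Local Open Scope ring_scope.
Local Open Scope ereal_scope.

Notation borelType T := (g_sigma_algebraType (@open T)).

(* On a second countable locally compact Hausdorff space, these Borel measures
   are exactly the (automatically regular) Radon measures. *)
Definition locally_finite (T : ptopologicalType) (R : realType)
    (mu : {measure set (borelType T) -> \bar R}) : Prop :=
  forall x : T, exists2 U : set T, open_nbhs x U & mu U < +oo.

Definition measure_support (T : ptopologicalType) (R : realType)
    (mu : {measure set (borelType T) -> \bar R}) : set T :=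
  [set x | forall U : set T, open_nbhs x U -> 0 < mu U].

Definition potential (T : ptopologicalType) (R : realType)
    (G : T -> T -> \bar R)
    (nu : {measure set (borelType T) -> \bar R}) (x : T) : \bar R :=
  \int[nu]_y G x y.

(* The potential of the measure u^q sigma, with the convention 0 * +oo = 0. *)
Definition potential_pow (T : ptopologicalType) (R : realType)
    (G : T -> T -> \bar R) (sigma : {measure set (borelType T) -> \bar R})
    (q : R) (u : T -> \bar R) (x : T) : \bar R :=
  \int[sigma]_y (G x y * u y `^ q).

Definition quasi_symmetric (T : Type) (R : realType)
    (G : T -> T -> \bar R) : Prop :=
  exists2 a : R, (0 < a)%R &
    forall x y, a^-1%:E * G y x <= G x y /\ G x y <= a%:E * G y x.

Definition weak_maximum_principle (T : ptopologicalType) (R : realType)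
    (G : T -> T -> \bar R) : Prop :=
  exists2 h : R, (1 <= h)%R &
    forall (M : R) (nu : {measure set (borelType T) -> \bar R}),
      (0 < M)%R -> locally_finite nu ->
      (forall x, measure_support nu x -> potential G nu x <= M%:E) ->
      forall x, potential G nu x <= (h * M)%:E.

Definition degenerate (T : ptopologicalType) (R : realType)
    (G : T -> T -> \bar R)
    (sigma : {measure set (borelType T) -> \bar R}) : Prop :=
  exists A : set (borelType T),
    [/\ measurable A, 0 < sigma A &
        forall y, A y -> {ae sigma, forall x, G x y = 0}].

(* The library's Lfun only contains real-valued functions; here u may take
   infinite values. *)
Definition in_Lq (T : ptopologicalType) (R : realType)
    (sigma : {measure set (borelType T) -> \bar R})
    (q : R) (u : borelType T -> \bar R) : Prop :=
  measurable_fun [set: borelType T] u /\ 'N[sigma]_(q%:E)[u] < +oo.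

Definition strong_type_inequality (T : ptopologicalType) (R : realType)
    (G : T -> T -> \bar R) (sigma : {measure set (borelType T) -> \bar R})
    (q : R) : Prop :=
  exists2 kappa : R, (0 < kappa)%R &
    forall nu : {measure set (borelType T) -> \bar R}, locally_finite nu ->
      'N[sigma]_(q%:E)[potential G nu] <= kappa%:E * nu [set: T].

Definition has_positive_supersolution (T : ptopologicalType) (R : realType)
    (G : T -> T -> \bar R) (sigma : {measure set (borelType T) -> \bar R})
    (q : R) : Prop :=
  exists2 u : borelType T -> \bar R, in_Lq sigma q u &
    {ae sigma, forall x, potential_pow G sigma q u x <= u x /\
                         (0 < u x /\ u x < +oo)}.

Definition has_positive_solution (T : ptopologicalType) (R : realType)
    (G : T -> T -> \bar R) (sigma : {measure set (borelType T) -> \bar R})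
    (q : R) : Prop :=
  exists2 u : borelType T -> \bar R, in_Lq sigma q u &
    {ae sigma, forall x, u x = potential_pow G sigma q u x /\
                         (0 < u x /\ u x < +oo)}.

(* Main.v *)
(* (1) => (2), (3).  For 0 < q < 1 the map f |-> max (g, (G (f sigma))^q) is
   bounded on L^1(sigma) by (1), and sublinear growth keeps its increasing
   iterates from 0 in a ball; the limit f is a fixed point, and u = f^(1/q) is
   a supersolution, or a solution when g <= (G (g sigma))^q.  The weak maximum
   principle applied to Dirac masses shows that G (x, x) = 0 forces
   G (., x) = 0; so in the non-degenerate case sigma-almost every x has, by
   lower semicontinuity, a basic neighbourhood e with G bounded below on e x e,
   and a rapidly decreasing combination g of the indicators of these e is such
   a subsolution.

   (2) => (1).  Replacing G by max (G (x, y), G (y, x)), let G be symmetric, and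
   let omega = u^q sigma, so that G omega <= C u.  The main point is the
   weak-type bound t omega {t G omega < G nu} <= 4 h |nu|.  On a subset E of the
   left-hand set where G omega is bounded and G nu is bounded below, take a
   probability measure mu on E whose energy is almost minimal, equal to v say.
   Cutting mu off to the closed set {G mu <= 2 v} loses little mass, bounds its
   potential by 2 h v everywhere (weak maximum principle), and, by the first
   variation of the energy in the direction of omega restricted to E, keeps
   the integral of the potential over E above v omega(E) / 2.  No weak
   compactness of measures is needed.  A dyadic decomposition of the values of
   G nu / u turns the weak-type bound into (1). *)

From HB Require Import structures.
Require Import Defs.
From mathcomp Require Import all_boot all_order all_algebra.
From mathcomp Require Import all_classical all_reals all_analysis measurable_realfun.
From mathcomp Require Import ring lra.

Set Implicit Arguments.
Unset Strict Implicit.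
Unset Printing Implicit Defensive.
Import Order.TTheory GRing.Theory Num.Theory.
Import numFieldNormedType.Exports.

Local Open Scope classical_set_scope.
Local Open Scope ring_scope.
Local Open Scope ereal_scope.

(** * Lower semicontinuity and measurability *)

Lemma second_countable_seq (T : ptopologicalType) : @second_countable T ->
  exists e : nat -> set T, (forall n, open (e n)) /\
    forall x A, nbhs x A -> exists2 n, e n x & e n `<=` A.
Proof.
move=> [B /countable_injP[f finj] [Bo Bn]].
(* Indices outside the range of the injection [f] receive the default [setT], which is open, so the
   sequence still consists of open sets. *)
exists (fun n => xget setT [set U | B U /\ f U = n]); split=> [n|x A xA].
  by case: xgetP => [U _ [/Bo]//|_]; exact: openT.
have [U [BU Ux] UA] := Bn x A xA.
exists (f U); case: xgetP => [V _ [BV fVU]|/(_ U)[]//];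
  by rewrite (finj V U)// inE.
Qed.

Lemma open_measurable_borel (T : ptopologicalType) (U : set T) :
  open U -> measurable (U : set (borelType T)).
Proof. exact: sub_sigma_algebra. Qed.

(** Measurability here is for the product of the two Borel sigma-algebras, not the Borel
    sigma-algebra of the product. Second countability bridges the two: [O] is the countable union of
    the basic rectangles that it contains. *)
Lemma open_measurable_prod (T : ptopologicalType) (O : set (T * T)) :
  @second_countable T -> open O ->
  measurable (O : set (borelType T * borelType T)).
Proof.
move=> /second_countable_seq[e [eo en]] oO.
have -> : O = \bigcup_k \bigcup_(l in [set l | e k `*` e l `<=` O])
    (e k `*` e l).
  apply/seteqP; split => [[x y] Oxy|[x y] [k _] [l /= kl [ekx ely]]]; last first.
    exact: kl.
  have [[A1 A2] [/= /en[k kx kA] /en[l ly lA]] AO] := open_nbhs_nbhs (conj oO Oxy).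
  exists k => //; exists l => //= -[x' y'] [/= ? ?]; apply: AO.
  by split; [exact: kA|exact: lA].
apply: bigcup_measurable => k _; apply: bigcup_measurable => l _.
by apply: measurableX; exact: open_measurable_borel.
Qed.

Lemma measurable_fun_open_gt d (X : measurableType d) (R : realType)
    (f : X -> \bar R) :
  (forall a : R, measurable [set x | a%:E < f x]) -> measurable_fun setT f.
Proof.
move=> mf; apply: (measurability _ (ErealGenOInfty.measurableE R)).
move=> /= _ [_ [a ->]] <-; apply: measurableI => //.
by rewrite preimage_itvoy; exact: mf.
Qed.

Lemma lsc_measurable_prod (R : realType) (T : ptopologicalType)
    (G : T * T -> \bar R) :
  @second_countable T -> lower_semicontinuous G ->
  measurable_fun setT (G : borelType T * borelType T -> \bar R).
Proof.
move=> cT /lower_semicontinuousP lscG; apply: measurable_fun_open_gt => a.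
exact: open_measurable_prod.
Qed.

Lemma lsc_measurable (R : realType) (T : ptopologicalType) (f : T -> \bar R) :
  lower_semicontinuous f -> measurable_fun setT (f : borelType T -> \bar R).
Proof.
move=> /lower_semicontinuousP lscf; apply: measurable_fun_open_gt => a.
exact: open_measurable_borel.
Qed.

Lemma lsc_sectionr (R : realType) (T : ptopologicalType) (G : T * T -> \bar R) x :
  lower_semicontinuous G -> lower_semicontinuous (fun y => G (x, y)).
Proof.
move=> lscG y a /lscG[V [[A1 A2] [/= xA1 yA2] AV] VG].
exists A2 => // z zA; apply/VG/AV; split => //=; exact: nbhs_singleton.
Qed.

Lemma lsc_sectionl (R : realType) (T : ptopologicalType) (G : T * T -> \bar R) y :
  lower_semicontinuous G -> lower_semicontinuous (fun x => G (x, y)).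
Proof.
move=> lscG x a /lscG[V [[A1 A2] [/= xA1 yA2] AV] VG].
exists A1 => // z zA; apply/VG/AV; split => //=; exact: nbhs_singleton.
Qed.

Lemma ereal_dense (R : realType) (x y : \bar R) :
  0 <= x -> x < y -> exists2 r : R, x < r%:E & r%:E < y.
Proof.
case: x => [r _|_|//]; case: y => [s rs|_|]//.
  by exists ((r + s) / 2)%R; rewrite lte_fin; move: rs; rewrite lte_fin => ?; lra.
by exists (r + 1)%R; rewrite ?ltey// lte_fin; lra.
Qed.

(** Tonelli's theorem asks for a sigma-finite structure, while the measures below are plain ones
    with a finiteness hypothesis. *)
Lemma finite_measure_sigma_finite d (X : measurableType d) (R : realType)
    (mu : {measure set X -> \bar R}) :
  mu setT < +oo -> exists m : {sigma_finite_measure set X -> \bar R},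
    forall A, m A = mu A.
Proof.
move=> muT.
have sf : sigma_finite setT mu.
  by exists (fun=> setT) => [|i]//; rewrite bigcup_const.
pose H1 := isSFinite.Build _ _ _ _ (sfinite_measure_sigma_finite sf).
pose H2 := isSigmaFinite.Build _ _ _ _ sf.
by exists (HB.pack_for {sigma_finite_measure set X -> \bar R}
  (Measure.sort mu) H1 H2).
Qed.

Lemma finite_tonelli d d' (X : measurableType d) (Y : measurableType d')
    (R : realType) (mu : {measure set X -> \bar R})
    (nu : {measure set Y -> \bar R}) (f : X * Y -> \bar R) :
  mu setT < +oo -> nu setT < +oo -> measurable_fun setT f ->
  (forall z, 0 <= f z) ->
  \int[mu]_x \int[nu]_y f (x, y) = \int[nu]_y \int[mu]_x f (x, y).
Proof.
move=> /finite_measure_sigma_finite[m mE] /finite_measure_sigma_finite[n nE].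
move=> mf f0.
transitivity (\int[m]_x \int[n]_y f (x, y)).
  rewrite (eq_measure_integral m) => [|A _ _]; last exact/esym/mE.
  apply: eq_integral => x _.
  by apply: eq_measure_integral => A _ _; exact/esym/nE.
rewrite (@fubini_tonelli _ _ _ _ _ m n f mf f0).
transitivity (\int[n]_y \int[mu]_x f (x, y)).
  apply: eq_integral => x _.
  by apply: eq_measure_integral => A _ _; exact: mE.
by apply: eq_measure_integral => A _ _; exact: nE.
Qed.

(** Fatou's lemma needs sequences, and second countability supplies them. If the claim failed at
    [x], points [z n] tending to [x] would have potential at most [a], and Fatou with the lower
    semicontinuity of each [G (., y)] would give the same bound at [x]. *)
Lemma potential_lsc (R : realType) (T : ptopologicalType) (G : T -> T -> \bar R)
    (nu : {measure set (borelType T) -> \bar R}) :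
  @second_countable T -> (forall x y, 0 <= G x y) ->
  lower_semicontinuous (fun p : T * T => G p.1 p.2) ->
  lower_semicontinuous (potential G nu).
Proof.
move=> /second_countable_seq[e [eo en]] G0 lscG x a ax.
apply: contrapT => noV.
(* The intersection of those among the first [n] basic sets that contain [x]: a decreasing
   neighbourhood basis. *)
pose W n := [set z | forall k, (k < n)%N -> e k x -> e k z].
have Wx n : nbhs x (W n).
  elim: n => [|n IH]; first exact: filterE.
  have [enx|nenx] := pselect (e n x); last first.
    apply: filterS IH => z Wz k; rewrite ltnS leq_eqVlt => /predU1P[->//|].
    exact: Wz.
  have : nbhs x (e n) by apply: open_nbhs_nbhs.
  apply: filterS2 IH => z Wz ez k; rewrite ltnS leq_eqVlt => /predU1P[->//|].
  exact: Wz.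
have /choice[z zP] : forall n, exists z, W n z /\ potential G nu z <= a%:E.
  move=> n; apply: contrapT => nz; apply: noV; exists (W n) => // y Wy.
  by rewrite ltNge; apply/negP => ya; apply: nz; exists y.
have mG v : measurable_fun setT (G v : borelType T -> \bar R).
  by apply: lsc_measurable; exact: (lsc_sectionr (G := fun p => G p.1 p.2)).
have := @fatou _ _ _ nu setT measurableT (fun n y => G (z n) y) (fun n => mG _)
  (fun n y _ => G0 _ _).
apply/negP; rewrite -ltNge; apply: (@le_lt_trans _ _ a%:E).
  rewrite limn_einf_lim; apply: lime_le; first exact: is_cvg_einfs.
  apply: nearW => n; apply: le_trans (proj2 (zP n)).
  by apply: ereal_inf_lbound; exists n => /=.
apply: lt_le_trans ax _; apply: ge0_le_integral => //.
  apply: (emeasurable_fun_cvg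
    (fun k (y : borelType T) => einfs (fun n => G (z n) y) k)).
    exact: measurable_fun_einfs.
  by move=> y _; rewrite limn_einf_lim; exact: is_cvg_einfs.
move=> y _; rewrite leNgt limn_einf_lim; apply/negP => lt_G.
have lim0 : 0 <= limn (einfs (fun n => G (z n) y)).
  apply: lime_ge; first exact: is_cvg_einfs.
  by apply: nearW => n; apply: le_ereal_inf_tmp => _ [k _ <-].
have [b lb bG] := ereal_dense lim0 lt_G.
have [V xV VG] := @lsc_sectionl _ _ _ y lscG _ _ bG.
have [k kx kV] := en _ _ xV.
move: lb; apply/negP; rewrite -leNgt.
apply: lime_ge; first exact: is_cvg_einfs.
(* [W m] only involves indices below [m], so [z m] is known to lie in [e k] from [k.+1] on. *)
exists k.+1 => // n /= kn; apply: le_ereal_inf_tmp => _ [m /= nm <-].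
apply/ltW/VG/kV; apply: (proj1 (zP m)) => //.
exact: leq_trans nm.
Qed.

(** * Measures with a density *)

(** The product of extended reals is discontinuous only at [0 * +oo]. If [c = 0] the sequence is
    constant, and if [l = 0] monotonicity forces every [u n] to vanish; so infinite values of
    kernels and densities are harmless. *)
Lemma cvgeZl_nondecreasing (R : realType) (u : nat -> \bar R) (c l : \bar R) :
  0 <= c -> (forall n, 0 <= u n) -> nondecreasing_seq u ->
  u @ \oo --> l -> c * u n @[n --> \oo] --> c * l.
Proof.
move=> c0 u0 ndu ul.
have [->|cN0] := eqVneq c 0.
  by under eq_fun do rewrite mul0e; rewrite mul0e; exact: cvg_cst.
have [l0|lN0] := eqVneq l 0; last first.
  apply: cvgeM => //; last exact: cvg_cst.
  by rewrite mule_defE (negbTE cN0) (negbTE lN0).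
have un0 n : u n = 0.
  apply: le_anti; rewrite u0 andbT -l0 -(cvg_lim _ ul)//.
  by apply: lime_ge; [exact: cvgP ul|exists n => // m; exact: ndu].
by under eq_fun do rewrite un0 mule0; rewrite l0 mule0; exact: cvg_cst.
Qed.

Section density.
Context d (X : measurableType d) (R : realType).
Variables (mu : {measure set X -> \bar R}) (f : X -> \bar R).
Hypotheses (mf : measurable_fun setT f) (f0 : forall x, 0 <= f x).

(** The proofs are arguments so that the measure structure can be attached to [mdensity] itself. *)
Definition mdensity of measurable_fun setT f & (forall x, 0 <= f x) :=
  fun A : set X => \int[mu]_(x in A) f x.

Local Notation dens := (mdensity mf f0).

Let dens0 : dens set0 = 0. Proof. by rewrite /mdensity integral_set0. Qed.

Let dens_ge0 A : 0 <= dens A. Proof. exact: integral_ge0. Qed.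

Let dens_sigma_additive : semi_sigma_additive dens.
Proof. exact: semi_sigma_additive_nng_induced. Qed.

HB.instance Definition _ := isMeasure.Build _ _ _ dens
  dens0 dens_ge0 dens_sigma_additive.

Import HBNNSimple.

Let integral_dens_indic E : measurable E ->
  \int[dens]_x (\1_E x)%:E = \int[mu]_x ((\1_E x)%:E * f x).
Proof.
move=> mE; rewrite integral_indic// setIT.
transitivity (\int[mu]_(x in E) f x) => //; rewrite integral_mkcond.
by apply: eq_integral => x _; rewrite patchE indicE; case: ifPn => _;
  rewrite ?mul1e ?mul0e.
Qed.

Let integral_dens_nnsfun (h : {nnsfun X >-> R}) :
  \int[dens]_x (h x)%:E = \int[mu]_x ((h x)%:E * f x).
Proof.
under [LHS]eq_integral do rewrite fimfunE -fsumEFin//.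
rewrite [LHS]ge0_integral_fsum//; last 2 first.
  - by move=> r; exact/measurable_EFinP/measurableT_comp.
  - by move=> n x _; rewrite EFinM nnfun_muleindic_ge0.
under [RHS]eq_integral.
  move=> x xD; rewrite fimfunE -fsumEFin// ge0_mule_fsuml; last first.
    by move=> r; rewrite EFinM nnfun_muleindic_ge0.
  over.
rewrite [RHS]ge0_integral_fsum//; last 2 first.
  - move=> r; apply: emeasurable_funM => //.
    exact/measurable_EFinP/measurableT_comp.
  - by move=> n x _; rewrite mule_ge0// EFinM nnfun_muleindic_ge0.
apply: eq_fsbigr => r _.
rewrite (@integralZl_indic_nnsfun _ _ _ dens _ measurableT).
rewrite integral_dens_indic//.
have [r0|r0] := leP 0%R r.
  rewrite -ge0_integralZl//.
  - by apply: eq_integral => x _; rewrite EFinM muleA.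
  - by apply: emeasurable_funM => //; exact/measurable_EFinP.
  - by move=> x _; rewrite mule_ge0// lee_fin.
(* For [r < 0] the level set of a nonnegative simple function is empty, and both sides vanish. *)
rewrite preimage_nnfun0// integral0_eq => [|x _]; last first.
  by rewrite indic0 mul0e.
rewrite mule0 integral0_eq// => x _.
by rewrite indic0 mulr0 mul0e.
Qed.

Lemma ge0_integral_mdensity (g : X -> \bar R) : measurable_fun setT g ->
  (forall x, 0 <= g x) -> \int[dens]_x g x = \int[mu]_x (g x * f x).
Proof.
move=> mg g0; pose g_ := nnsfun_approx measurableT mg.
have g_cvg x : EFin \o g_ ^~ x @ \oo --> g x by exact: cvg_nnsfun_approx.
have g_nd x : nondecreasing_seq (fun n => (g_ n x)%:E).
  by move=> a b ab; rewrite lee_fin; exact/lefP/nd_nnsfun_approx.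
transitivity (limn (fun n => \int[dens]_x (g_ n x)%:E)).
  rewrite -monotone_convergence//=.
  - by apply: eq_integral => x _; apply/esym/cvg_lim => //=; exact: g_cvg.
  - by move=> n; apply: measurableT_comp.
  - by move=> n x _; rewrite lee_fin.
transitivity (limn (fun n => \int[mu]_x ((g_ n x)%:E * f x))); last first.
  rewrite -monotone_convergence//=.
  - apply: eq_integral => x _; apply/cvg_lim => //=.
    under eq_fun do rewrite muleC; rewrite muleC.
    apply: cvgeZl_nondecreasing => //; last exact: g_cvg.
    by move=> n; rewrite lee_fin.
  - move=> n; apply: emeasurable_funM => //; exact/measurable_EFinP.
  - by move=> n x _; rewrite mule_ge0// lee_fin.
  - by move=> x _ a b ab; rewrite lee_wpmul2r//; exact: g_nd.
by congr (limn _); apply/funext => n; exact: integral_dens_nnsfun.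
Qed.

End density.

(** * Energy and the weak-type estimate *)

Lemma ge0_integral_mrestr d (X : measurableType d) (R : realType)
    (mu : {measure set X -> \bar R}) (B : set X) (mB : measurable B)
    (g : X -> \bar R) : measurable_fun setT g -> (forall x, 0 <= g x) ->
  \int[mrestr mu mB]_x g x = \int[mu]_(x in B) g x.
Proof.
move=> mg g0.
have m1 : measurable_fun setT (EFin \o (\1_B : X -> R)) by exact/measurable_EFinP.
have p1 x : 0 <= (EFin \o (\1_B : X -> R)) x by rewrite lee_fin.
transitivity (\int[mdensity mu m1 p1]_x g x).
  apply: eq_measure_integral => A mA _.
  rewrite /= /mrestr /mdensity integral_indic//.
  by rewrite setIC.
rewrite ge0_integral_mdensity// [RHS]integral_mkcond.
apply: eq_integral => x _; rewrite patchE /= indicE.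
by case: ifPn => _; rewrite ?mule1 ?mule0.
Qed.

(** * Integration against a measure carried by a set *)

Section concentrated.
Context d (X : measurableType d) (R : realType).
Variables (mu : {measure set X -> \bar R}) (E B : set X).
Hypotheses (mE : measurable E) (mB : measurable B) (muE : mu (~` E) = 0).

Lemma concentrated_measureI : mu (B `&` E) = mu B.
Proof.
rewrite [RHS](measureDI mu mB mE) [X in X + _](_ : _ = 0) ?add0e//.
apply: subset_measure0 muE; [exact: measurableD|exact: measurableC|].
by move=> x [].
Qed.

Variable f : X -> \bar R.
Hypotheses (mf : measurable_fun setT f) (f0 : forall x, 0 <= f x).

Lemma concentrated_integralI :
  \int[mu]_(x in B) f x = \int[mu]_(x in B `&` E) f x.
Proof.
rewrite (@ge0_negligible_integral _ _ _ mu B (~` E))//.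
- by rewrite setDE setCK.
- exact: measurableC.
- exact: measurable_funTS.
Qed.

Lemma concentrated_integral_ge (c : R) : (0 <= c)%R ->
  (forall x, E x -> c%:E <= f x) -> c%:E * mu B <= \int[mu]_(x in B) f x.
Proof.
move=> c0 cf; rewrite concentrated_integralI -concentrated_measureI.
rewrite -integral_cst//; last exact: measurableI.
apply: ge0_le_integral => //; [exact: measurableI| |].
  exact: measurable_funTS.
by move=> x [_ /cf].
Qed.

Lemma concentrated_integral_le (c : R) :
  (forall x, E x -> f x <= c%:E) -> \int[mu]_(x in B) f x <= c%:E * mu B.
Proof.
move=> cf; rewrite concentrated_integralI -concentrated_measureI.
rewrite -integral_cst//; last exact: measurableI.
apply: ge0_le_integral => //; [exact: measurableI| |].
- exact: measurable_funTS.
- by move=> x [_ /cf].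
Qed.

End concentrated.

(** The hypotheses give [e / 2 <= 2 h c n], whereas [e / 2 = 2 h c (n + 1)]. *)
Lemma min_energy_gt0_arith (R : realFieldType) (e h c n a : R) : (0 < e ->
  e * a <= h * (2 * c) * n -> 4 * h * (n + 1) * c = e ->
  e * (1 / 2) <= e * a -> 0 < h * c -> False)%R.
Proof. move=> *; nra. Qed.

(** Here [v] is the minimal energy, [v + d] bounds the energy of the near minimiser, [a] is the mass
    lost by the cut-off and [j] the energy left; [M] and [w] are the mass and energy of the
    perturbing measure, [s] its weight, [x] the mutual energy. The two bounds on [j] give
    [v a^2 <= d], hence [a <= 1/4]. Expanding the last hypothesis gives
    [2 s v M (1 - a) <= d + 2 s x + s v M / 4], and the left side is at least [3 s v M / 2]. *)
Lemma equilibrium_arith (R : realFieldType) (v M w s d a j x : R) : (0 < v ->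
  0 < M -> 0 < s -> 0 <= a -> s * w = v * M / 4 ->
  d <= s * (v * M) / 4 -> d <= v / 16 ->
  v * (1 - a) ^+ 2 <= j -> j + 2 * v * a <= v + d ->
  v * (1 - a + s * M) ^+ 2 <= j + s * x + (s * x + s * (s * w)) ->
  v / 2 * M <= x)%R.
Proof.
move=> v0 M0 s0 a0 sw ds dv vj jv; rewrite sw => vx.
have a4 : (a <= 1 / 4)%R.
  rewrite leNgt; apply/negP => a4.
  have : (v * (a * a) <= v * (1 / 16))%R by lra.
  rewrite ler_pM2l//; nra.
have vM0 : (0 < v * M)%R by rewrite mulr_gt0.
have s20 : (0 < 2 * s)%R by lra.
rewrite -(ler_pM2l s20).
have h1 : (2 * s * (v * M) * (1 - a) + v * (s * M) ^+ 2 + v * (a * a)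
     <= d + 2 * s * x + s * (v * M / 4))%R.
  lra.
have h2 : (0 <= v * (s * M) ^+ 2)%R by rewrite mulr_ge0 ?sqr_ge0 ?ltW.
have h3 : (0 <= v * (a * a))%R := mulr_ge0 (ltW v0) (mulr_ge0 a0 a0).
have h4 : (s * (v * M) * (3 / 4) <= s * (v * M) * (1 - a))%R.
  by rewrite ler_pM2l ?mulr_gt0//; lra.
have h5 : (0 < s * (v * M))%R by rewrite mulr_gt0.
lra.
Qed.

(** * Energies for a symmetric kernel with a maximum principle *)

Section energy.
Context (R : realType) (T : ptopologicalType).
Hypothesis second_countableT : @second_countable T.
Variable K : T -> T -> \bar R.
Hypothesis K0 : forall x y, 0 <= K x y.
Hypothesis lscK : lower_semicontinuous (fun p : T * T => K p.1 p.2).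
Implicit Types mu nu om : {measure set (borelType T) -> \bar R}.

Lemma measurable_kernel :
  measurable_fun setT (fun p : borelType T * borelType T => K p.1 p.2).
Proof. exact: (lsc_measurable_prod (G := fun p : T * T => K p.1 p.2)). Qed.

Lemma measurable_kernel_section x :
  measurable_fun setT (K x : borelType T -> \bar R).
Proof.
by apply: lsc_measurable; exact: (lsc_sectionr (G := fun p : T * T => K p.1 p.2)).
Qed.

Lemma measurable_potential mu :
  measurable_fun setT (potential K mu : borelType T -> \bar R).
Proof. by apply: lsc_measurable; exact: potential_lsc. Qed.

Lemma potential_ge0 mu x : 0 <= potential K mu x.
Proof. exact: integral_ge0. Qed.

Definition mutual_energy mu nu := \int[nu]_x potential K mu x.

Lemma mutual_energy_ge0 mu nu : 0 <= mutual_energy mu nu.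
Proof. by apply: integral_ge0 => x _; exact: potential_ge0. Qed.

Lemma mutual_energyDl mu1 mu2 nu :
  mutual_energy (measure_add mu1 mu2) nu =
  mutual_energy mu1 nu + mutual_energy mu2 nu.
Proof.
rewrite /mutual_energy -ge0_integralD//.
- apply: eq_integral => x _; rewrite /potential ge0_integral_measure_add//.
  exact: measurable_kernel_section.
- by move=> x _; exact: potential_ge0.
- exact: measurable_potential.
- by move=> x _; exact: potential_ge0.
- exact: measurable_potential.
Qed.

Lemma mutual_energyDr mu nu1 nu2 :
  mutual_energy mu (measure_add nu1 nu2) =
  mutual_energy mu nu1 + mutual_energy mu nu2.
Proof.
rewrite /mutual_energy ge0_integral_measure_add//.
  by move=> x _; exact: potential_ge0.
exact: measurable_potential.
Qed.

Lemma mutual_energyZl (r : {nonneg R}) mu nu :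
  mutual_energy (mscale r mu) nu = r%:num%:E * mutual_energy mu nu.
Proof.
rewrite /mutual_energy -ge0_integralZl//.
- apply: eq_integral => x _; rewrite /potential ge0_integral_mscale//.
  exact: measurable_kernel_section.
- exact: measurable_potential.
- by move=> x _; exact: potential_ge0.
Qed.

Lemma mutual_energyZr (r : {nonneg R}) mu nu :
  mutual_energy mu (mscale r nu) = r%:num%:E * mutual_energy mu nu.
Proof.
rewrite /mutual_energy ge0_integral_mscale//.
  exact: measurable_potential.
by move=> x _; exact: potential_ge0.
Qed.

Hypothesis symK : forall x y, K x y = K y x.

Lemma mutual_energyC mu nu : mu setT < +oo -> nu setT < +oo ->
  mutual_energy mu nu = mutual_energy nu mu.
Proof.
move=> muT nuT; rewrite /mutual_energy /potential.
rewrite (finite_tonelli (f := fun p : borelType T * borelType T => K p.1 p.2))//.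
  by apply: eq_integral => x _; apply: eq_integral => y _ /=.
exact: measurable_kernel.
Qed.

Variable h : R.
Hypothesis h0 : (0 < h)%R.
Hypothesis wmpK : forall (M : R) mu, (0 < M)%R -> mu setT < +oo ->
  (forall x, measure_support mu x -> potential K mu x <= M%:E) ->
  forall x, potential K mu x <= (h * M)%:E.

Let sublevel mu M := [set x : borelType T | potential K mu x <= M%:E].

Lemma measurable_sublevel mu M : measurable (sublevel mu M).
Proof.
rewrite -[sublevel _ _]setTI; apply: emeasurable_fun_infty_c => //.
exact: measurable_potential.
Qed.

(** The sublevel set is closed by lower semicontinuity, so it contains the support of the restricted
    measure. Restriction lowers the potential, which is thus at most [M] on that support, and the
    maximum principle spreads the bound. *)
Lemma potential_sublevel_bounded mu (M : R) : (0 < M)%R -> mu setT < +oo ->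
  forall x, potential K (mrestr mu (measurable_sublevel mu M)) x <= (h * M)%:E.
Proof.
move=> M0 muT.
set nu := mrestr _ _.
have nu_mu x : potential K nu x <= potential K mu x.
  rewrite /potential /nu ge0_integral_mrestr//; last first.
    exact: measurable_kernel_section.
  apply: ge0_subset_integral => //; first exact: measurable_sublevel.
  exact: measurable_kernel_section.
apply: wmpK => // [|x suppx].
  apply: le_lt_trans muT; rewrite /nu /= /mrestr; apply: le_measure; rewrite ?inE//.
  by apply: measurableI => //; exact: measurable_sublevel.
apply: le_trans (nu_mu x) _; rewrite leNgt; apply/negP => Mx.
have opM : open [set x | M%:E < potential K mu x].
  by move: M {M0 nu nu_mu suppx Mx}; apply/lower_semicontinuousP/potential_lsc.
have := suppx _ (conj opM Mx).
rewrite /nu /= /mrestr [X in mu X](_ : _ = set0) ?measure0 ?ltxx//.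
by apply/seteqP; split => // y /= []; rewrite /sublevel/= leNgt => ->.
Qed.

(** * Minimal energy and approximate equilibrium measures *)

Section equilibrium.
Variables (om : {measure set (borelType T) -> \bar R}) (E : set (borelType T)).
Hypotheses (mE : measurable E) (omT : om setT < +oo).

Definition unit_on mu := mu setT = 1 /\ mu (~` E) = 0.

Definition min_energy := ereal_inf [set mutual_energy mu mu | mu in unit_on].

Lemma min_energy_ge0 : 0 <= min_energy.
Proof. by apply: le_ereal_inf_tmp => _ [mu _ <-]; exact: mutual_energy_ge0. Qed.

(** Normalising [mu] divides its energy by the square of its mass. A null measure, which cannot be
    normalised, is settled by [0 * +oo = 0], whatever the value of [min_energy]. *)
Lemma min_energy_le mu : mu setT < +oo -> mu (~` E) = 0 ->
  min_energy * (mu setT * mu setT) <= mutual_energy mu mu.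
Proof.
move=> muT muE; have muT_fin : mu setT \is a fin_num by rewrite ge0_fin_numE.
have := fineK muT_fin; move: (fine _) (fine_ge0 (measure_ge0 mu setT)) => r r0 rE.
have [r00|r_neq0] := eqVneq r 0%R.
  by rewrite -rE r00 !mule0 mutual_energy_ge0.
have rV0 : (0 <= r^-1)%R by rewrite invr_ge0.
have unit_mu : unit_on (mscale (NngNum rV0) mu).
  by split; rewrite /= /mscale /= ?muE ?mule0// -rE -EFinM mulVf.
have : min_energy <= mutual_energy (mscale (NngNum rV0) mu) (mscale (NngNum rV0) mu).
  by apply: ereal_inf_lbound; exists (mscale (NngNum rV0) mu).
rewrite mutual_energyZl mutual_energyZr /= => le_min.
rewrite -rE -EFinM.
have -> : mutual_energy mu mu =
    (r^-1)%:E * ((r^-1)%:E * mutual_energy mu mu) * (r * r)%:E.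
  rewrite muleA -EFinM muleAC -EFinM (_ : (_ * _)%R = 1%R) ?mul1e//.
  by field.
by apply: lee_wpmul2r le_min; rewrite lee_fin mulr_ge0.
Qed.

(** A unit measure on [E] of energy below [c] has, by Chebyshev, at least half its mass where its
    potential is at most [2 c]. That part has potential at most [2 h c] everywhere; pairing it with
    [nu] gives [e / 2 <= 2 h c nu(T)], which is false for [c] small. *)
Lemma min_energy_gt0 nu (e : R) : nu setT < +oo -> (0 < e)%R ->
  (forall x, E x -> e%:E <= potential K nu x) -> 0 < min_energy.
Proof.
move=> nuT e0 nuE; have nuT_fin : nu setT \is a fin_num by rewrite ge0_fin_numE.
have := fineK nuT_fin; move: (fine _) (fine_ge0 (measure_ge0 nu setT)) => n n0 nE.
(* The [+ 1] allows for a null [nu] and makes the final contradiction strict. *)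
pose c := (e / (4 * h * (n + 1)))%R.
have n10 : (0 < n + 1)%R by lra.
have c0 : (0 < c)%R by rewrite divr_gt0// !mulr_gt0.
apply: (@lt_le_trans _ _ c%:E); first by rewrite lte_fin.
apply: le_ereal_inf_tmp => _ [mu [muT muE] <-].
rewrite leNgt; apply/negP => lt_c.
have mS := measurable_sublevel mu (2 * c).
have muToo : mu setT < +oo by rewrite muT ltey.
have c20 : (0 < 2 * c)%R by rewrite mulr_gt0.
have bound := potential_sublevel_bounded c20 muToo.
set muB := mrestr mu _ in bound.
have muBoo : muB setT < +oo.
  by apply: le_lt_trans muToo; rewrite /muB /= /mrestr setTI le_measure ?inE.
have fin A : measurable A -> mu A \is a fin_num.
  move=> mA; rewrite ge0_fin_numE//; apply: le_lt_trans muToo.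
  by rewrite le_measure ?inE.
have mSC : measurable (~` sublevel mu (2 * c)) by exact: measurableC.
have split_mu : mu (sublevel mu (2 * c)) + mu (~` sublevel mu (2 * c)) = 1.
  by rewrite -measureU ?setUv// setICr.
have half : (2 * c)%:E * mu (~` sublevel mu (2 * c)) <= c%:E.
  apply: le_trans (ltW lt_c).
  rewrite -integral_cst//; apply: (@le_trans _ _
    (\int[mu]_(x in ~` sublevel mu (2 * c)) potential K mu x)).
    apply: ge0_le_integral => //.
    + by move=> x _; rewrite lee_fin ltW.
    + by apply: measurable_funTS; exact: measurable_potential.
    + by move=> x /negP; rewrite /sublevel/= -ltNge => /ltW.
  apply: ge0_subset_integral => //; first exact: measurable_potential.
  by move=> x _; exact: potential_ge0.
have lower : e%:E * mu (sublevel mu (2 * c)) <= (h * (2 * c))%:E * nu setT.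
  apply: (@le_trans _ _ (mutual_energy nu muB)).
    rewrite /mutual_energy ge0_integral_mrestr//; last 2 first.
    - exact: measurable_potential.
    - by move=> x; exact: potential_ge0.
    apply: (@concentrated_integral_ge _ _ _ mu E) => //.
    - exact: measurable_potential.
    - by move=> x; exact: potential_ge0.
    - exact: ltW.
  rewrite mutual_energyC// -integral_cst//; apply: ge0_le_integral => //.
  - by move=> x _; exact: potential_ge0.
  - exact: measurable_potential.
move: split_mu half lower; rewrite -nE -(fineK (fin _ mS)) -(fineK (fin _ mSC)).
move: (fine _) (fine _) => b a.
rewrite -EFinD -!EFinM !lee_fin => -[ab] half lower.
have ca : (4 * h * (n + 1) * c = e)%R.
  by rewrite /c mulrC divfK// gt_eqF// !mulr_gt0.
have b2 : (b <= 1/2)%R.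
  by rewrite -(ler_pM2l c20) (le_trans half)//; lra.
have a2 : (e * (1/2) <= e * a)%R by rewrite ler_pM2l//; lra.
have hc0 : (0 < h * c)%R by rewrite mulr_gt0.
exact: min_energy_gt0_arith e0 lower ca a2 hc0.
Qed.

(** An approximate equilibrium measure: its potential is bounded above everywhere, but below only on
    average against [om]. The measure [nu] makes the minimal energy [v] positive; the bound [N]
    makes the energy of [om] restricted to [E] finite, hence [v] finite too. *)
Lemma equilibrium_measure nu (e N : R) : nu setT < +oo -> (0 < e)%R ->
  (forall x, E x -> e%:E <= potential K nu x) -> 
  (forall x, E x -> potential K om x <= N%:E) -> 0 < om E ->
  exists (mu : {measure set (borelType T) -> \bar R}) (v : R),
   [/\ (0 < v)%R, mu setT < +oo, mu (~` E) = 0,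
     forall x, potential K mu x <= (2 * h * v)%:E &
     (v / 2)%:E * om E <= \int[om]_(x in E) potential K mu x].
Proof.
move=> nuT e0 nuE omE omE0.
have min0 := min_energy_gt0 nuT e0 nuE.
have omEfin : om E \is a fin_num.
  by rewrite ge0_fin_numE//; apply: le_lt_trans omT; rewrite le_measure ?inE.
have := fineK omEfin; move: (fine _) => M ME.
have M0 : (0 < M)%R by rewrite -lte_fin ME.
pose lam : {measure set (borelType T) -> \bar R} := mrestr om mE.
have lamT : lam setT = M%:E by rewrite /lam /= /mrestr setTI ME.
have lamToo : lam setT < +oo by rewrite lamT ltey.
have lamE : lam (~` E) = 0 by rewrite /lam /= /mrestr setICl measure0.
have lam_om x : potential K lam x <= potential K om x.
  rewrite /potential /lam ge0_integral_mrestr//; last first.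
    exact: measurable_kernel_section.
  by apply: ge0_subset_integral => //; exact: measurable_kernel_section.
have lamN x : E x -> potential K lam x <= N%:E.
  by move=> Ex; exact: le_trans (omE _ Ex).
have mpot mu := measurable_potential mu.
have pot0 mu x := potential_ge0 mu x.
have energy_lam mu : mu setT < +oo -> mu (~` E) = 0 ->
    mutual_energy lam mu <= N%:E * mu setT.
  by move=> ? ?; apply: (@concentrated_integral_le _ _ _ mu E).
have Wfin : mutual_energy lam lam \is a fin_num.
  rewrite ge0_fin_numE ?mutual_energy_ge0//.
  by apply: le_lt_trans (energy_lam _ lamToo lamE) _; rewrite lamT -EFinM ltey.
have := min_energy_le lamToo lamE.
have := fineK Wfin; move: (fine _) => w wE; rewrite -wE lamT -EFinM.
have : min_energy \is a fin_num.
  rewrite ge0_fin_numE ?min_energy_ge0// ltey; apply/eqP => minoo.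
  have := min_energy_le lamToo lamE.
  by rewrite minoo lamT -EFinM mulyr gtr0_sg ?mulr_gt0// mul1e -wE.
move=> /fineK; move: (fine _) => v vE; rewrite -vE -EFinM lee_fin => vw.
have v0 : (0 < v)%R by rewrite -lte_fin vE.
have w0 : (0 < w)%R by apply: lt_le_trans vw; rewrite !mulr_gt0.
(* With this weight the second-order term [s^2 w] of the competitor's energy is only [s v M / 4]. *)
have [s s0 sw] : exists2 s : R, (0 < s)%R & (s * w = v * M / 4)%R.
  exists (v * M / (4 * w))%R; first by rewrite divr_gt0 ?mulr_gt0.
  by rewrite invfM mulrA divfK// gt_eqF.
(* The excess energy must be small against the first-order gain, of size [s v M], and against [v],
   so that the cut-off loses at most a quarter of the mass. *)
have [d d0 /andP[ds dv]] : exists2 d : R, (0 < d)%R &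
    (d <= s * (v * M) / 4)%R && (d <= v / 16)%R.
  exists (Num.min (s * (v * M) / 4) (v / 16))%R.
    by rewrite lt_min !divr_gt0 ?mulr_gt0 ?mulr_gt0.
  by rewrite !ge_min !lexx orbT.
have : min_energy < (v + d)%:E by rewrite -vE lte_fin ltrDl.
move=> /ereal_inf_lt[_ [mu [muT muE] <-]] mu_d.
have muToo : mu setT < +oo by rewrite muT ltey.
have v20 : (0 < 2 * v)%R by rewrite mulr_gt0.
pose S := sublevel mu (2 * v); have mS : measurable S := measurable_sublevel _ _.
have mSC : measurable (~` S) by exact: measurableC.
have muB_bound := potential_sublevel_bounded v20 muToo.
pose muB : {measure set (borelType T) -> \bar R} :=
  mrestr mu (measurable_sublevel mu (2 * v)).
have muBT : muB setT = mu S by rewrite /muB /= /mrestr setTI.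
have muBoo : muB setT < +oo.
  by rewrite muBT; apply: le_lt_trans muToo; rewrite le_measure ?inE.
have muBE : muB (~` E) = 0.
  rewrite /muB /= /mrestr; apply: subset_measure0 muE => //.
  - by apply: measurableI => //; exact: measurableC.
  - exact: measurableC.
exists muB, v; split => //.
  by move=> x; apply: le_trans (muB_bound x) _; rewrite lee_fin mulrCA mulrA.
have -> : \int[om]_(x in E) potential K muB x = mutual_energy muB lam.
  by rewrite /mutual_energy /lam ge0_integral_mrestr.
have muB_lam : mutual_energy muB lam = mutual_energy lam muB.
  exact: mutual_energyC.
have Xfin : mutual_energy muB lam \is a fin_num.
  rewrite ge0_fin_numE ?mutual_energy_ge0// muB_lam.
  apply: le_lt_trans (energy_lam _ muBoo muBE) _.
  have : muB setT \is a fin_num by rewrite ge0_fin_numE.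
  by move=> /fineK <-; rewrite -EFinM ltey.
have fin A : measurable A -> mu A \is a fin_num.
  move=> mA; rewrite ge0_fin_numE//; apply: le_lt_trans muToo.
  by rewrite le_measure ?inE.
have split_mu : mu S + mu (~` S) = 1 by rewrite -measureU ?setUv// setICr.
(* On [S] the potential of [mu] dominates that of [muB]; off [S] it exceeds [2 v]. *)
have split_energy : mutual_energy muB muB + (2 * v)%:E * mu (~` S) <=
    mutual_energy mu mu.
  rewrite [leRHS]/mutual_energy -(setUv S) ge0_integral_setU//; last 2 first.
  - by rewrite setUv.
  - exact/disj_setPCl.
  apply: leeD.
    rewrite /mutual_energy /muB ge0_integral_mrestr//.
    apply: ge0_le_integral => //; try exact: measurable_funTS.
    move=> x _; rewrite /potential ge0_integral_mrestr//; last first.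
      exact: measurable_kernel_section.
    by apply: ge0_subset_integral => //; exact: measurable_kernel_section.
  rewrite -integral_cst//; apply: ge0_le_integral => //.
  - by move=> x _; rewrite lee_fin ltW.
  - exact: measurable_funTS.
  - by move=> x /negP; rewrite /S /sublevel/= -ltNge => /ltW.
have Jfin : mutual_energy muB muB \is a fin_num.
  rewrite ge0_fin_numE ?mutual_energy_ge0//.
  apply: (@le_lt_trans _ _ (mutual_energy mu mu)); last first.
    by apply: lt_trans mu_d _; rewrite ltey.
  by apply: le_trans split_energy; rewrite leeDl// mule_ge0// lee_fin ltW.
(* The competitor muB + s lam: its energy is at least v times the square of its
   mass, which for small s bounds the mutual energy of muB and lam below. *)
pose mut : {measure set (borelType T) -> \bar R} :=
  measure_add muB (mscale (NngNum (ltW s0)) lam).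
have mutAE A : mut A = muB A + s%:E * lam A by exact: measure_addE.
have mutT : mut setT = mu S + (s * M)%:E by rewrite mutAE muBT lamT.
have mutToo : mut setT < +oo.
  by rewrite mutT -(fineK (fin _ mS)) -EFinD ltey.
have mutE : mut (~` E) = 0.
  by rewrite mutAE muBE lamE mule0 adde0.
have := min_energy_le mutToo mutE.
have := min_energy_le muBoo muBE.
have := le_lt_trans split_energy mu_d.
rewrite /mut mutual_energyDl !mutual_energyDr !mutual_energyZl !mutual_energyZr.
rewrite -/mut mutT muBT -muB_lam -wE -vE.
have SC0 : 0 <= mu (~` S) by exact: measure_ge0.
move: SC0 split_mu; rewrite -ME.
move: Xfin Jfin (fin _ mS) (fin _ mSC).
move=> /fineK <- /fineK <- /fineK <- /fineK <-.
move: (fine _) (fine _) (fine _) (fine _) => x j b a.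
rewrite -!(EFinM, EFinD) lte_fin !lee_fin => a0 [ba] jd vj vx.
have {ba}bE : b = (1 - a)%R by rewrite -ba addrK.
move: vj vx; rewrite bE -!expr2 => vj vx.
exact: (equilibrium_arith v0 M0 s0 a0 sw ds dv vj (ltW jd)).
Qed.
End equilibrium.

(** With [mu] and [v] from [equilibrium_measure], symmetry gives [t (v / 2) om(E) <= t \int_E K om
    dmu <= \int K nu dmu = \int K mu dnu <= 2 h v nu(T)], and [v] cancels. *)
Lemma weak_type_restricted om nu (E : set (borelType T)) (t e N : R) :
  om setT < +oo -> nu setT < +oo -> measurable E -> (0 < t)%R -> (0 < e)%R ->
  (forall x, E x -> e%:E <= potential K nu x) ->
  (forall x, E x -> potential K om x <= N%:E) ->
  (forall x, E x -> t%:E * potential K om x <= potential K nu x) ->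
  t%:E * om E <= (4 * h)%:E * nu setT.
Proof.
move=> omT nuT mE t0 e0 nuE omE om_nu.
have := measure_ge0 om E; rewrite le_eqVlt => /predU1P[<-|omE0].
  by rewrite mule0 mule_ge0// lee_fin mulr_ge0// ltW.
have [mu [v [v0 muT muE mu_bound mu_lower]]] :=
  equilibrium_measure mE omT nuT e0 nuE omE omE0.
have mpot mu' := measurable_potential mu'.
have pot0 mu' x := potential_ge0 mu' x.
have lower : (v / 2)%:E * om E <= \int[mu]_(x in E) potential K om x.
  apply: (le_trans mu_lower).
  apply: (@le_trans _ _ (mutual_energy mu om)).
    by apply: ge0_subset_integral.
  rewrite mutual_energyC// /mutual_energy.
  by rewrite (@concentrated_integralI _ _ _ mu E setT)// setTI.
have upper : t%:E * \int[mu]_(x in E) potential K om x <= (2 * h * v)%:E * nu setT.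
  rewrite -ge0_integralZl//; last 2 first.
  - exact: measurable_funTS.
  - by rewrite lee_fin ltW.
  apply: (@le_trans _ _ (\int[mu]_(x in E) potential K nu x)).
    apply: ge0_le_integral => //.
    - by move=> x _; rewrite mule_ge0// lee_fin ltW.
    - by apply: measurable_funeM; exact: measurable_funTS.
    - exact: measurable_funTS.
  apply: (@le_trans _ _ (mutual_energy nu mu)).
    by apply: ge0_subset_integral.
  rewrite mutual_energyC// -integral_cst//.
  by apply: ge0_le_integral.
have te0 : 0 <= t%:E by rewrite lee_fin ltW.
have v20 : 0 <= (2 / v)%:E by rewrite lee_fin divr_ge0// ltW.
have := lee_wpmul2l v20 (le_trans (lee_wpmul2l te0 lower) upper).
rewrite muleCA !muleA -!EFinM.
rewrite (_ : (t * (2 / v) * (v / 2))%R = t); last by field; exact: lt0r_neq0.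
rewrite (_ : (2 / v * (2 * h * v))%R = (4 * h)%R)//; by field; exact: lt0r_neq0.
Qed.

(** The strict inequality forces [potential K nu > 0] and [potential K om < +oo], so the set is the
    increasing union of the pieces [E n] on which [weak_type_restricted] applies with a bound
    independent of [n]. *)
Lemma weak_type om nu (t : R) :
  om setT < +oo -> nu setT < +oo -> (0 < t)%R ->
  t%:E * om [set x | t%:E * potential K om x < potential K nu x] <=
  (4 * h)%:E * nu setT.
Proof.
move=> omT nuT t0.
have mpot mu' := measurable_potential mu'.
have pot0 mu' x := potential_ge0 mu' x.
pose E n := [set x : borelType T | n.+1%:R^-1%:E <= potential K nu x] `&`
  [set x | potential K om x <= n%:R%:E] `&`
  [set x | t%:E * potential K om x < potential K nu x].
have mlt : measurable
    [set x : borelType T | t%:E * potential K om x < potential K nu x].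
  rewrite -[X in measurable X]setTI; apply: measurable_lte => //.
  exact: measurable_funeM.
have mE n : measurable (E n).
  apply: measurableI => //; apply: measurableI.
    by rewrite -[X in measurable X]setTI; exact: emeasurable_fun_c_infty.
  by rewrite -[X in measurable X]setTI; exact: emeasurable_fun_infty_c.
have -> : [set x : borelType T | t%:E * potential K om x < potential K nu x] =
    \bigcup_n E n.
  apply/seteqP; split => [x /= om_nu|x [n _ [_]]//].
  have nu0 : 0 < potential K nu x.
    by apply: le_lt_trans om_nu; rewrite mule_ge0// lee_fin ltW.
  have omoo : potential K om x \is a fin_num.
    rewrite ge0_fin_numE// ltey; apply/eqP => omx.
    by move: om_nu; rewrite omx gt0_muley ?lte_fin// ltNge leey.
  have [r r0 rnu] := ereal_dense (lexx 0) nu0.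
  rewrite lte_fin in r0.
  have [n1 n1r] : exists n, (n.+1%:R^-1 <= r)%R.
    by have [n] := ltr_add_invr r0; rewrite add0r => /ltW; exists n.
  have [n2 n2om] : exists n, (fine (potential K om x) <= n%:R)%R.
    exists (Num.truncn (fine (potential K om x))).+1.
    exact/ltW/Num.Theory.truncnS_gt.
  exists (maxn n1 n2) => //; split => //; split => /=.
    apply: le_trans (ltW rnu); rewrite lee_fin; apply: le_trans n1r.
    by rewrite lef_pV2 ?posrE// ler_nat ltnS leq_maxl.
  rewrite -(fineK omoo) lee_fin (le_trans n2om)//.
  by rewrite ler_nat leq_maxr.
have ndE : nondecreasing_seq E.
  move=> m n mn; apply/subsetPset => x [[]] /= nux omx ?; split => //; split => /=.
    apply: le_trans nux; rewrite lee_fin.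
    by rewrite lef_pV2 ?posrE// ler_nat ltnS.
  by apply: le_trans omx _; rewrite lee_fin ler_nat.
have cvgE := nondecreasing_cvg_mu mE (bigcup_measurable (fun n _ => mE n)) ndE.
have cvgtE : t%:E * (om \o E) n @[n --> \oo] --> t%:E * om (\bigcup_n E n).
  by apply: cvgeZl => //; exact: cvgE.
rewrite -(cvg_lim _ cvgtE)//; apply: lime_le; first exact: cvgP cvgtE.
apply: nearW => n /=.
apply: (@weak_type_restricted om nu (E n) t n.+1%:R^-1 n%:R) => //.
- by move=> x [[]].
- by move=> x [[]].
- by move=> x [_ /ltW].
Qed.
End energy.

(** * From supersolutions to the strong-type inequality *)

Lemma le_poweR (R : realType) (r : R) (x y : \bar R) :
  (0 <= r)%R -> 0 <= x -> x <= y -> x `^ r <= y `^ r.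
Proof.
move=> r0 x0 xy; apply: gt0_ler_poweR => //; rewrite in_itv/= leey andbT//.
exact: le_trans x0 xy.
Qed.

(** To be used with [F] and [U] the values at one point of the potential and of [u], and [b k] the
    indicator of [2^k tau u < F]. Below [tau U] the first term suffices; between [2^k tau U] and
    [2^(k+1) tau U] the term of index [k] does. *)
Lemma dyadic_bound (R : realType) (q tau U : R) (F : \bar R) (b : nat -> R) :
  (0 < q)%R -> (0 < tau)%R -> (0 < U)%R -> 0 <= F -> (forall k, 0 <= b k)%R ->
  (forall k, (2 ^+ k * tau * U)%:E < F -> b k = 1%R) ->
  F `^ q <= ((tau `^ q)%:E +
    \sum_(0 <= k <oo) ((2 ^+ k.+1 * tau) `^ q * b k)%:E) * (U `^ q)%:E.
Proof.
move=> q0 tau0 U0 F0 b0 b1.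
set B := leRHS.
have [q_ge0 tau_ge0 U_ge0] := And3 (ltW q0) (ltW tau0) (ltW U0).
have term0 k : 0 <= ((2 ^+ k.+1 * tau) `^ q * b k)%:E :> \bar R.
  by rewrite lee_fin mulr_ge0// powR_ge0.
have sum0 : 0 <= \sum_(0 <= k <oo) ((2 ^+ k.+1 * tau) `^ q * b k)%:E :> \bar R.
  exact: nneseries_ge0.
have Uq0 : 0 <= (U `^ q)%:E by rewrite lee_fin powR_ge0.
have B0 : 0 <= B by rewrite mule_ge0// adde_ge0// lee_fin powR_ge0.
(* Stated for all reals below [F] so as to cover [F = +oo]: a finite [B] is then refuted by
   [y = (B + 1)^(1/q)]. *)
have key y : (0 <= y)%R -> y%:E <= F -> (y `^ q)%:E <= B.
  move=> y0 yF; have [y_small|y_large] := leP y (tau * U)%R.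
    apply: (@le_trans _ _ ((tau `^ q)%:E * (U `^ q)%:E)).
      by rewrite -EFinM lee_fin -powRM// ge0_ler_powR ?nnegrE ?mulr_ge0.
    by rewrite lee_wpmul2r// leeDl.
  have tauU0 : (0 < tau * U)%R by rewrite mulr_gt0.
  have exn : exists n, (y <= 2 ^+ n * (tau * U))%R.
    exists (Num.truncn (y / (tau * U))).+1.
    rewrite -ler_pdivrMr// (le_trans (ltW (Num.Theory.truncnS_gt _)))//.
    by rewrite -natrX ler_nat ltnW// ltn_expl.
  case: (ex_minnP exn) => -[|k]; first by rewrite expr0 mul1r leNgt y_large.
  move=> yk kmin.
  have ky : (2 ^+ k * (tau * U) < y)%R.
    by rewrite ltNge; apply/negP => /kmin; rewrite ltnn.
  apply: (@le_trans _ _ (((2 ^+ k.+1 * tau) `^ q * b k)%:E * (U `^ q)%:E)).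
    rewrite b1 ?mulr1; last by apply: lt_le_trans yF; rewrite lte_fin -mulrA.
    rewrite -EFinM lee_fin -powRM ?mulr_ge0 ?exprn_ge0//.
    by rewrite -mulrA ge0_ler_powR ?nnegrE// ?mulr_ge0 ?mulr_ge0 ?exprn_ge0.
  rewrite lee_wpmul2r//.
  apply: (@le_trans _ _ (\sum_(0 <= k <oo) ((2 ^+ k.+1 * tau) `^ q * b k)%:E)).
    apply: le_trans (nneseries_lim_ge k.+1 (fun n _ _ => term0 n)).
    by rewrite big_nat_recr//= leeDr// sume_ge0.
  by rewrite leeDr// lee_fin powR_ge0.
move: F0 key {b1}; case: F => [r r0 key|_ key|//]; first exact: key.
have [Bfin|] := boolP (B \is a fin_num); last first.
  by rewrite ge0_fin_numE// -leNgt leye_eq => /eqP ->; rewrite leey.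
have M0 : (0 <= fine B + 1)%R by rewrite addr_ge0// fine_ge0.
have := key ((fine B + 1) `^ q^-1)%R (powR_ge0 _ _) (leey _).
rewrite -powRrM mulVf ?gt_eqF// powRr1// -[leRHS](fineK Bfin) lee_fin.
by rewrite gerDl ler10.
Qed.

(** The hypothesis is the weak-type bound at level [2^k tau] for a measure of mass [tau]. It gives
    [m <= D / 2^k], so the dyadic terms decay geometrically with ratio [2^q / 2], which is below 1
    when [q < 1]. *)
Lemma dyadic_term_le (R : realType) (q tau D m : R) (k : nat) : (0 < tau ->
  2 ^+ k * tau * m <= D * tau ->
  (2 ^+ k.+1 * tau) `^ q * m <=
  tau `^ q * D * 2 `^ q * (2 `^ q / 2) ^+ k)%R.
Proof.
move=> tau0 mD; have k0 : (0 < 2 ^+ k :> R)%R by rewrite exprn_gt0.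
have mDk : (m <= D / 2 ^+ k)%R.
  by rewrite ler_pdivlMr// mulrC -(ler_pM2r tau0) mulrAC.
have -> : ((2 ^+ k.+1 * tau) `^ q = 2 `^ q * ((2 `^ q) ^+ k * tau `^ q))%R.
  rewrite exprS -mulrA !powRM ?mulr_ge0 ?(ltW tau0) ?(ltW k0)//.
  by rewrite -(powR_mulrn k)// powRAC powR_mulrn ?powR_ge0.
rewrite expr_div_n; set A := (2 `^ q)%R; set B := (tau `^ q)%R.
have AB0 : (0 <= A * (A ^+ k * B))%R.
  by rewrite mulr_ge0 ?mulr_ge0 ?exprn_ge0 ?powR_ge0.
apply: le_trans (ler_wpM2l AB0 mDk) _; rewrite le_eqVlt; apply/orP; left.
by apply/eqP; ring.
Qed.

Lemma nneseries_geometric_le (R : realType) (c r : R) :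
  (0 <= c)%R -> (0 <= r < 1)%R ->
  \sum_(0 <= k <oo) (c * r ^+ k)%:E <= (c / (1 - r))%:E.
Proof.
move=> c0 /andP[r0 r1]; apply: lime_le.
  by apply: is_cvg_nneseries => k _ _; rewrite lee_fin mulr_ge0 ?exprn_ge0.
apply: nearW => n; rewrite sumEFin lee_fin.
have -> : (\sum_(0 <= k < n) c * r ^+ k = series (geometric c r) n)%R by [].
rewrite geometric_seriesE ?lt_eqF//= ler_pM2r ?invr_gt0 ?subr_gt0//.
by rewrite ler_piMr// gerBl exprn_ge0.
Qed.

Lemma powR2_half_lt1 (R : realType) (q : R) : (q < 1 -> 2 `^ q / 2 < 1 :> R)%R.
Proof.
move=> q1; rewrite ltr_pdivrMr// mul1r.
have p0 : (0 < 2 `^ q :> R)%R by rewrite powR_gt0.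
rewrite [ltRHS](_ : _ = 2 `^ q * 2 `^ (1 - q))%R; last first.
  rewrite -powRD ?pnatr_eq0 ?implybT//.
  by rewrite addrC subrK powRr1.
rewrite ltr_pMr//.
have : (1 `^ (1 - q) < 2 `^ (1 - q) :> R)%R.
  by rewrite gt0_ltr_powR ?nnegrE ?subr_gt0// ltr1n.
by rewrite powR1.
Qed.

(** * Reduction to a symmetric kernel *)

Section symmetrized_kernel.
Context (R : realType) (T : ptopologicalType) (G : T -> T -> \bar R).
Hypothesis G0 : forall x y, 0 <= G x y.
Hypothesis lscG : lower_semicontinuous (fun p : T * T => G p.1 p.2).

(* The maximum, unlike the sum, is lower semicontinuous without any case
   distinction on vanishing terms. *)
Definition symmetrized x y := maxe (G x y) (G y x).

Lemma symmetrized_ge0 x y : 0 <= symmetrized x y.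
Proof. by rewrite le_max G0. Qed.

Lemma symmetrizedC x y : symmetrized x y = symmetrized y x.
Proof. exact: maxC. Qed.

Lemma le_symmetrized x y : G x y <= symmetrized x y.
Proof. by rewrite le_max lexx. Qed.

Lemma symmetrized_lsc :
  lower_semicontinuous (fun p : T * T => symmetrized p.1 p.2).
Proof.
move=> [x y] a /=; rewrite lt_max => /orP[] /(lscG (x := (_, _)))[V [[A B]]] /=.
- move=> [xA yB] AV VG; exists (A `*` B); first by exists (A, B).
  by move=> p /AV/VG pG; rewrite lt_max pG.
- move=> [yA xB] AV VG; exists (B `*` A); first by exists (B, A).
  move=> p [pB pA]; have := VG (p.2, p.1) (AV (p.2, p.1) (conj pA pB)) => /= pG.
  by rewrite lt_max pG orbT.
Qed.

Hypothesis qsymG : quasi_symmetric G.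

Lemma symmetrized_le : exists2 a : R, (0 < a)%R &
  forall x y, symmetrized x y <= a%:E * G x y.
Proof.
case: qsymG => a a0 aG; exists (1 + a)%R => [|x y]; first by rewrite addr_gt0.
have a_ge0 : 0 <= a%:E by rewrite lee_fin ltW.
rewrite ge_max EFinD ge0_muleDl// mul1e leeDl ?mule_ge0//=.
by apply: le_trans (proj2 (aG y x)) _; rewrite leeDr.
Qed.

End symmetrized_kernel.

Section supersolution_strong_type.
Context (R : realType) (T : ptopologicalType).
Hypothesis second_countableT : @second_countable T.
Variables (G : T -> T -> \bar R).
Hypothesis G0 : forall x y, 0 <= G x y.
Hypothesis lscG : lower_semicontinuous (fun p : T * T => G p.1 p.2).
Variables (sigma : {measure set (borelType T) -> \bar R}) (q : R).
Hypotheses (q0 : (0 < q)%R) (q1 : (q < 1)%R).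

Lemma finite_locally_finite (mu : {measure set (borelType T) -> \bar R}) :
  mu setT < +oo -> locally_finite mu.
Proof. by move=> muT x; exists setT => //; split => //; exact: openT. Qed.

Lemma Lnorm_lt_pinfty (f : borelType T -> \bar R) :
  'N[sigma]_(q%:E)[f] < +oo <-> \int[sigma]_x (`|f x| `^ q) < +oo.
Proof.
have qV : (q^-1 != 0)%R by rewrite invr_eq0 gt_eqF.
rewrite unlock; split; first exact: lty_poweRy.
exact: poweR_lty.
Qed.

Hypothesis qsymG : quasi_symmetric G.
Hypothesis wmpG : weak_maximum_principle G.

(** The bound on the support passes to [G] because [G <= symmetrized G]; the conclusion comes back
    through [symmetrized G <= a G], which costs the factor [a]. *)
Lemma symmetrized_weak_maximum : exists2 h : R, (0 < h)%R &
  forall (M : R) (mu : {measure set (borelType T) -> \bar R}),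
  (0 < M)%R -> mu setT < +oo ->
  (forall x, measure_support mu x -> potential (symmetrized G) mu x <= M%:E) ->
  forall x, potential (symmetrized G) mu x <= (h * M)%:E.
Proof.
have [a a0 aG] := symmetrized_le G0 qsymG.
have [h h1 hG] := wmpG.
exists (a * h)%R; first by rewrite mulr_gt0// (lt_le_trans _ h1).
have mG x : measurable_fun setT (G x : borelType T -> \bar R).
  exact: measurable_kernel_section.
have mS x : measurable_fun setT (symmetrized G x : borelType T -> \bar R).
  by apply: measurable_kernel_section; exact: symmetrized_lsc.
have S0 := symmetrized_ge0 G0.
move=> M mu M0 muT muM x.
apply: (@le_trans _ _ (a%:E * potential G mu x)).
  rewrite /potential -ge0_integralZl//; last by rewrite lee_fin ltW.
  apply: ge0_le_integral => //; exact: measurable_funeM.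
rewrite -mulrA EFinM; apply: lee_wpmul2l; first by rewrite lee_fin ltW.
apply: hG => //; first exact: finite_locally_finite.
move=> y /muM; apply: le_trans; apply: ge0_le_integral => //.
by move=> z _; exact: le_symmetrized.
Qed.

Lemma supersolution_strong_type :
  has_positive_supersolution G sigma q -> strong_type_inequality G sigma q.
Proof.
move=> [u [mu_ Nu] u_super].
pose f (y : borelType T) := u y `^ q.
have mf : measurable_fun setT f.
  exact: (measurableT_comp (measurable_poweR _)).
have f0 x : 0 <= f x by exact: poweR_ge0.
pose om : {measure set (borelType T) -> \bar R} := mdensity sigma mf f0.
have omT : om setT < +oo.
  move/Lnorm_lt_pinfty : Nu; apply: le_lt_trans.
  rewrite /om /= /mdensity; apply: ae_ge0_le_integral => //.
  - by move=> x _; exact: poweR_ge0.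
  - apply: (measurableT_comp (measurable_poweR _)).
    exact: measurableT_comp.
  - case: u_super => N [mN sN0 superN]; exists N; split => // x nle.
    by apply: superN => -[_ [ux _]]; apply: nle => _; rewrite gee0_abs// ltW.
have omTfin : om setT \is a fin_num by rewrite ge0_fin_numE.
have [a a0 aG] := symmetrized_le G0 qsymG.
have [h h0 hK] := symmetrized_weak_maximum.
have mG x : measurable_fun setT (G x : borelType T -> \bar R).
  exact: measurable_kernel_section.
pose K := symmetrized G.
have K0 : forall x y, 0 <= K x y := symmetrized_ge0 G0.
have lscK := symmetrized_lsc lscG.
have mK x : measurable_fun setT (K x : borelType T -> \bar R).
  exact: measurable_kernel_section.
have pot_om x : potential K om x <= a%:E * potential_pow G sigma q u x.
  rewrite /potential ge0_integral_mdensity//.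
  rewrite -ge0_integralZl//; last 3 first.
  - exact: emeasurable_funM.
  - by move=> y _; rewrite mule_ge0// poweR_ge0.
  - by rewrite lee_fin ltW.
  apply: ge0_le_integral => //.
  - by move=> y _; rewrite mule_ge0.
  - exact: emeasurable_funM.
  - by apply: measurable_funeM; exact: emeasurable_funM.
  - by move=> y _; rewrite muleA lee_wpmul2r.
have [N [mN sN0 superN]] := u_super.
have omN0 : om N = 0.
  by apply: null_set_integral => //; exact: measurable_funTS.
have mpK (nu : {measure set (borelType T) -> \bar R}) :
    measurable_fun setT (potential K nu : borelType T -> \bar R).
  exact: measurable_potential.
have mA (nu : {measure set (borelType T) -> \bar R}) (s : R) : measurable
    [set x : borelType T | s%:E * u x < potential K nu x].
  rewrite -[X in measurable X]setTI; apply: measurable_lte => //.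
  exact: measurable_funeM.
have weak (nu : {measure set (borelType T) -> \bar R}) (s : R) :
    nu setT < +oo -> (0 < s)%R ->
    s%:E * om [set x | s%:E * u x < potential K nu x] <=
    (4 * h * a)%:E * nu setT.
  (* Off the null set [N], [potential K om <= a u]; hence the set for [s] and [u] lies, up to [N],
     in the weak-type set for [s / a] and [om]. *)
  move=> nuT s0; have sa0 : (0 < s / a)%R by rewrite divr_gt0.
  have := weak_type second_countableT K0 lscK (@symmetrizedC _ _ G) h0 hK omT
    nuT sa0.
  set A' := [set x | _].
  have mA' : measurable (A' : set (borelType T)).
    rewrite -[A']setTI; apply: measurable_lte => //.
    by apply: measurable_funeM; exact: mpK.
  move=> weakA'.
  have omA : om [set x | s%:E * u x < potential K nu x] <= om A'.
    apply: (@le_trans _ _ (om (A' `|` N))).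
      apply: le_measure; rewrite ?inE//; first exact: measurableU.
      move=> x sx; have [|Nx] := pselect (N x); [by right|left].
      have [ux _] : potential_pow G sigma q u x <= u x /\ (0 < u x /\ u x < +oo).
        by apply: contrapT => nx; apply: Nx; exact: superN.
      apply: le_lt_trans sx; rewrite EFinM -muleA.
      apply: lee_wpmul2l; first by rewrite lee_fin ltW.
      rewrite -[leRHS]mul1e -(@mulVf _ a) ?gt_eqF// EFinM -muleA.
      apply: lee_wpmul2l; first by rewrite lee_fin invr_ge0 ltW.
      apply: le_trans (pot_om x) _; apply: lee_wpmul2l => //.
      by rewrite lee_fin ltW.
    apply: (le_trans (measureU2 om mA' mN)).
    by rewrite [X in _ + X]omN0 adde0.
  have sE y : s%:E * y = a%:E * ((s / a)%:E * y).
    by rewrite muleA -EFinM (mulrC a) divfK// gt_eqF.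
  rewrite [leLHS]sE (_ : (4 * h * a)%:E = a%:E * (4 * h)%:E); last first.
    by rewrite -EFinM mulrC.
  rewrite -muleA; apply: lee_wpmul2l; first by rewrite lee_fin ltW.
  apply: le_trans weakA'; apply: lee_wpmul2l; last exact: omA.
  by rewrite lee_fin ltW.
pose r := (2 `^ q / 2)%R : R.
have r01 : (0 <= r < 1)%R by rewrite powR2_half_lt1// divr_ge0 ?powR_ge0.
pose D := (4 * h * a)%R.
have D0 : (0 < D)%R by rewrite !mulr_gt0.
(* The two summands come from the constant term of [g] and from its geometric series, each
   integrated against [om]. *)
pose B := (fine (om setT) + D * 2 `^ q / (1 - r))%R.
have B0 : (0 < B)%R.
  rewrite ltr_wpDl ?fine_ge0// divr_gt0 ?mulr_gt0 ?powR_gt0//.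
  by rewrite subr_gt0; case/andP: r01.
exists (B `^ q^-1)%R; first by rewrite powR_gt0.
move=> nu _.
have [nuT|nuT] := boolP (nu setT \is a fin_num); last first.
  have -> : nu setT = +oo by apply/eqP; rewrite -leye_eq leNgt -ge0_fin_numE.
  by rewrite gt0_muley ?leey// lte_fin powR_gt0.
have nuToo : nu setT < +oo by rewrite -ge0_fin_numE.
(* The dyadic levels are multiples of the mass of [nu], which must be positive; a null [nu] has zero
   potential. *)
have := fine_ge0 (measure_ge0 nu setT); rewrite le_eqVlt => /predU1P[nu0|].
  have {}nu0 : nu setT = 0 by rewrite -(fineK nuT) -nu0.
  rewrite (_ : 'N[sigma]_(q%:E)[potential G nu] = 'N[sigma]_(q%:E)[cst 0]).
    by rewrite Lnorm0 ?eqe ?gt_eqF// nu0 mule0.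
  by apply: eq_Lnorm => x; apply: null_set_integral.
move: (fineK nuT); move: (fine _) => tau tauE tau0; rewrite -tauE.
pose A k := [set x : borelType T | (2 ^+ k * tau)%:E * u x < potential K nu x].
have mAk k : measurable (A k) by exact: mA.
pose c k := ((2 ^+ k.+1 * tau) `^ q)%R : R.
(* By [dyadic_bound], [g u^q] dominates the [q]-th power of the potential almost everywhere;
   integrating it amounts to integrating [g] against [om], so only the masses [om (A k)] matter. *)
pose g (x : borelType T) := (tau `^ q)%:E +
  \sum_(0 <= k <oo) (c k * \1_(A k) x)%:E.
have g_term0 k x : 0 <= (c k * \1_(A k) x)%:E :> \bar R.
  by rewrite lee_fin mulr_ge0// powR_ge0.
have mg_term k : measurable_fun setT (fun x => (c k * \1_(A k) x)%:E : \bar R).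
  apply/measurable_EFinP; apply: measurable_funM => //.
have g_sum0 x : 0 <= \sum_(0 <= k <oo) (c k * \1_(A k) x)%:E :> \bar R.
  exact: nneseries_ge0.
have g0 x : 0 <= g x.
  by apply: adde_ge0 => //; rewrite lee_fin powR_ge0.
have mg_sum : measurable_fun setT
    (fun x => \sum_(0 <= k <oo) (c k * \1_(A k) x)%:E : \bar R).
  exact: ge0_emeasurable_sum.
have mg : measurable_fun setT g by exact: emeasurable_funD.
have int_le : \int[sigma]_x (`|potential G nu x| `^ q) <= (tau `^ q * B)%:E.
  apply: (@le_trans _ _ (\int[sigma]_x (g x * f x))).
    apply: ae_ge0_le_integral => //.
    - by move=> x _; exact: poweR_ge0.
    - apply: (measurableT_comp (measurable_poweR _)).
      by apply: measurableT_comp => //; exact: measurable_potential.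
    - by move=> x _; rewrite mule_ge0.
    - exact: emeasurable_funM.
    exists N; split => // x nle; apply: superN => -[_ [ux0 uxoo]].
    apply: nle => _; rewrite gee0_abs ?potential_ge0//.
    apply: (@le_trans _ _ (potential K nu x `^ q)).
      apply: le_poweR; [exact: ltW|exact: potential_ge0|].
      by apply: ge0_le_integral => // y _; exact: le_symmetrized.
    have ufin : u x \is a fin_num by rewrite ge0_fin_numE// ltW.
    rewrite /f -(fineK ufin) poweR_EFin; apply: dyadic_bound => //.
    - by rewrite -lte_fin fineK.
    - exact: potential_ge0.
    - by move=> k; rewrite EFinM fineK// => Akx; rewrite indicE mem_set.
  rewrite -(ge0_integral_mdensity sigma mf f0)//.
  rewrite /g ge0_integralD//; last first.
    by move=> x _; rewrite lee_fin powR_ge0.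
  rewrite integral_cst// integral_nneseries//.
  rewrite -(fineK omTfin) -EFinM /B mulrDr EFinD; apply: leeD => //.
  apply: le_trans (_ : \sum_(0 <= k <oo) (tau `^ q * D * 2 `^ q * r ^+ k)%:E <= _).
    apply: lee_nneseries => [k _ _|k _]; first exact: integral_ge0.
    under eq_integral do rewrite EFinM.
    rewrite ge0_integralZl_EFin ?powR_ge0//; last exact/measurable_EFinP.
    rewrite integral_indic// setIT.
    have omAfin : om (A k) \is a fin_num.
      by rewrite ge0_fin_numE// (le_lt_trans _ omT)// le_measure ?inE.
    have k0 : (0 < 2 ^+ k * tau)%R by rewrite mulr_gt0// exprn_gt0.
    have := weak nu _ nuToo k0.
    rewrite -/(A k) -tauE -(fineK omAfin) -!EFinM !lee_fin.
    exact: dyadic_term_le.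
  apply: le_trans (nneseries_geometric_le _ r01) _.
    by apply: mulr_ge0 (powR_ge0 _ _); apply: mulr_ge0 (powR_ge0 _ _) (ltW D0).
  by rewrite lee_fin !mulrA.
rewrite unlock /Lnorm.
apply: le_trans (le_poweR _ _ int_le) _.
- by rewrite invr_ge0 ltW.
- by apply: integral_ge0 => x _; exact: poweR_ge0.
rewrite poweR_EFin -EFinM lee_fin powRM ?powR_ge0 ?(ltW B0)//.
by rewrite -powRrM mulfV ?gt_eqF// powRr1 ?(ltW tau0)// mulrC.
Qed.
End supersolution_strong_type.

(** * From the strong-type inequality to solutions *)

(** With [L = I + k^q + 1], the number [M = L^(1/(1-q))] solves [M = L M^q]. The [+ 1] ensures
    [M^q >= 1], so [I] is absorbed into [I M^q]. *)
Lemma iteration_bound (R : realType) (q k I : R) : (0 < q < 1 -> 0 < k ->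
  0 <= I -> exists2 M : R, 0 <= M & I + (k * M) `^ q <= M)%R.
Proof.
move=> /andP[q0 q1] k0 I0; pose L := (I + k `^ q + 1)%R.
have L1 : (1 <= L)%R by rewrite lerDr addr_ge0// powR_ge0.
have L0 : (0 <= L)%R by apply: le_trans L1.
exists (L `^ (1 - q)^-1)%R; first exact: powR_ge0.
set M := (L `^ _)%R.
have q1V : (0 < 1 - q)%R by rewrite subr_gt0.
have powR_ge1 (x y : R) : (0 <= y -> 1 <= x -> 1 <= x `^ y)%R.
  move=> y0 x1; have : (1 `^ y <= x `^ y)%R.
    by apply: ge0_ler_powR; rewrite ?nnegrE ?ler01// (le_trans ler01 x1).
  by rewrite powR1.
have M1 : (1 <= M `^ q)%R.
  by rewrite !powR_ge1 ?(ltW q0)// invr_ge0 ltW.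
have ME : M = (L * M `^ q)%R.
  rewrite /M -powRrM -[X in (X * _)%R](@powRr1 _ L)// -powRD; last first.
    by rewrite (lt0r_neq0 (lt_le_trans ltr01 L1)) implybT.
  congr (_ `^ _)%R; field; exact: lt0r_neq0.
rewrite [leRHS]ME powRM ?powR_ge0 ?(ltW k0)//.
apply: (@le_trans _ _ ((I + k `^ q) * M `^ q)%R).
  by rewrite mulrDl lerD2r ler_peMr.
by rewrite ler_wpM2r ?powR_ge0// lerDl.
Qed.

(** * Fixed points by monotone iteration *)

Section fixpoint.
Context (R : realType) (T : ptopologicalType).
Hypothesis second_countableT : @second_countable T.
Variables (G : T -> T -> \bar R).
Hypothesis G0 : forall x y, 0 <= G x y.
Hypothesis lscG : lower_semicontinuous (fun p : T * T => G p.1 p.2).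
Variables (sigma : {measure set (borelType T) -> \bar R}) (q : R).
Hypotheses (q0 : (0 < q)%R) (q1 : (q < 1)%R).

Definition density_potential (f : borelType T -> \bar R) (x : T) :=
  \int[sigma]_y (G x y * f y).

Local Notation P := density_potential.

Let mG x : measurable_fun setT (G x : borelType T -> \bar R).
Proof. exact: measurable_kernel_section. Qed.

Lemma density_potential_ge0 f x : (forall y, 0 <= f y) -> 0 <= P f x.
Proof. by move=> f0; apply: integral_ge0 => y _; rewrite mule_ge0. Qed.

Lemma le_density_potential f g x : measurable_fun setT f ->
  measurable_fun setT g -> (forall y, 0 <= f y) ->
  (forall y, f y <= g y) -> P f x <= P g x.
Proof.
move=> mf mg f0 fg; apply: ge0_le_integral => //.
- by move=> y _; rewrite mule_ge0.
- exact: emeasurable_funM.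
- exact: emeasurable_funM.
- by move=> y _; rewrite lee_wpmul2l.
Qed.

Lemma measurable_density_potential f : measurable_fun setT f ->
  (forall y, 0 <= f y) -> measurable_fun setT (P f : borelType T -> \bar R).
Proof.
move=> mf f0.
have -> : P f = potential G (mdensity sigma mf f0).
  by apply/funext => x; rewrite /potential ge0_integral_mdensity.
exact: measurable_potential.
Qed.

Lemma strong_type_density : strong_type_inequality G sigma q ->
  exists2 k : R, (0 < k)%R & forall f, measurable_fun setT f ->
    (forall y, 0 <= f y) -> \int[sigma]_y f y < +oo ->
    \int[sigma]_x (P f x `^ q) <= (k%:E * \int[sigma]_y f y) `^ q.
Proof.
move=> [k k0 kG]; exists k => // f mf f0 foo.
pose nu : {measure set (borelType T) -> \bar R} := mdensity sigma mf f0.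
have nuE : nu setT = \int[sigma]_y f y by [].
have nuT : nu setT < +oo by rewrite nuE.
have := kG nu (finite_locally_finite nuT); rewrite nuE.
move=> /(le_poweR (ltW q0) (Lnorm_ge0 _ _ _)); rewrite poweR_Lnorm ?gt_eqF//.
apply: le_trans; apply: ge0_le_integral => //.
- by move=> x _; exact: poweR_ge0.
- apply: (measurableT_comp (measurable_poweR _)).
  exact: measurable_density_potential.
- apply: (measurableT_comp (measurable_poweR _)); apply: measurableT_comp => //.
  exact: measurable_potential.
move=> x _; rewrite gee0_abs ?potential_ge0//.
by rewrite /potential ge0_integral_mdensity.
Qed.

Section iteration.
Variable g : borelType T -> \bar R.
Hypotheses (mg : measurable_fun setT g) (g0 : forall x, 0 <= g x).
Hypothesis goo : \int[sigma]_x g x < +oo.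

Let Phi f x := maxe (g x) (P f x `^ q).

Fixpoint sublinear_iter n : borelType T -> \bar R :=
  if n is n'.+1 then Phi (sublinear_iter n') else cst 0.

Local Notation F := sublinear_iter.

Lemma sublinear_iter_ge0 n x : 0 <= F n x.
Proof. by case: n => //= n; rewrite le_max g0. Qed.

Lemma measurable_sublinear_iter n : measurable_fun setT (F n).
Proof.
elim: n => [|n IH] /=; first exact: measurable_cst.
apply: measurable_maxe => //; apply: (measurableT_comp (measurable_poweR _)).
by apply: measurable_density_potential => // x; exact: sublinear_iter_ge0.
Qed.

Lemma sublinear_iterS_ge n x : F n x <= F n.+1 x.
Proof.
elim: n x => [|n IH] x /=; first by rewrite le_max g0.
rewrite ge_max !le_max lexx/=; apply/orP; right.
apply: le_poweR; first exact: ltW.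
  by apply: density_potential_ge0 => y; exact: sublinear_iter_ge0.
apply: le_density_potential => // [||y].
- exact: measurable_sublinear_iter.
- exact: (measurable_sublinear_iter n.+1).
- exact: sublinear_iter_ge0.
Qed.

(** [iteration_bound] keeps the integrals of the increasing iterates below one [M]. Monotone
    convergence is applied at each [x] separately, so the equation holds everywhere, not just almost
    everywhere. *)
Lemma sublinear_iter_fixpoint : strong_type_inequality G sigma q ->
  exists f : borelType T -> \bar R, [/\ measurable_fun setT f,
    forall x, 0 <= f x, \int[sigma]_x f x < +oo &
    forall x, f x = maxe (g x) (P f x `^ q)].
Proof.
move=> /strong_type_density[k k0 kP].
have gfin : \int[sigma]_x g x \is a fin_num.
  by rewrite ge0_fin_numE// integral_ge0.
have q01 : (0 < q < 1)%R by rewrite q0.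
have Ig0 : (0 <= fine (\int[sigma]_x g x))%R by rewrite fine_ge0// integral_ge0.
have [M M0 IM] := iteration_bound q01 k0 Ig0.
have ndF x : nondecreasing_seq (F ^~ x).
  by apply/nondecreasing_seqP => n; exact: sublinear_iterS_ge.
have mF := measurable_sublinear_iter.
have F0 := sublinear_iter_ge0.
have FM n : \int[sigma]_x F n x <= M%:E.
  elim: n => [|n IH]; first by rewrite integral0_eq.
  have Pq0 x : 0 <= P (F n) x `^ q by exact: poweR_ge0.
  have mPq : measurable_fun setT (fun x : borelType T => P (F n) x `^ q).
    apply: (measurableT_comp (measurable_poweR _)).
    exact: measurable_density_potential.
  apply: (@le_trans _ _ (\int[sigma]_x (g x + P (F n) x `^ q))).
    apply: ge0_le_integral => //.
      exact: emeasurable_funD.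
    by move=> x _ /=; rewrite ge_max leeDl// leeDr.
  rewrite ge0_integralD//.
  apply: le_trans (_ : ((fine (\int[sigma]_x g x))%:E + (k%:E * M%:E) `^ q) <= _).
    rewrite fineK// leeD2l//; apply: le_trans (kP _ (mF n) (F0 n) _) _.
      by apply: le_lt_trans IH _; rewrite ltey.
    apply: le_poweR; first exact: ltW.
      by rewrite mule_ge0// ?integral_ge0// lee_fin ltW.
    by apply: lee_wpmul2l => //; rewrite lee_fin ltW.
  by rewrite -EFinM poweR_EFin -EFinD lee_fin.
pose f x := limn (F ^~ x).
have Ff x : F ^~ x @ \oo --> f x by exact: ereal_nondecreasing_is_cvgn.
have F_le_f n x : F n x <= f x.
  by apply: lime_ge; [exact: cvgP (Ff x)|exists n => // m; exact: ndF].
have f0 x : 0 <= f x by exact: le_trans (F_le_f 0%N x).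
have mf : measurable_fun setT f.
  by apply: emeasurable_fun_cvg mF _ => x _; exact: Ff.
exists f; split => //.
  rewrite /f monotone_convergence//.
  apply: (@le_lt_trans _ _ M%:E); last by rewrite ltey.
  apply: lime_le; last exact: nearW.
  apply: ereal_nondecreasing_is_cvgn => m n mn.
  by apply: ge0_le_integral => // x _; exact: ndF.
have PfE x : P (F n) x @[n --> \oo] --> P f x.
  have lim_GF y : limn (fun n => G x y * F n y) = G x y * f y.
    apply/cvg_lim => //; apply: cvgeZl_nondecreasing => //; exact: Ff.
  rewrite /P; under [X in _ --> X]eq_integral do rewrite -lim_GF.
  apply: cvg_monotone_convergence => //.
  - by move=> n; exact: emeasurable_funM.
  - by move=> n y _; rewrite mule_ge0.
  - by move=> y _ m n mn; rewrite lee_wpmul2l//; exact: ndF.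
move=> x; apply: le_anti; apply/andP; split.
  apply: lime_le; first exact: cvgP (Ff x).
  apply: nearW => -[|n] /=; first by rewrite le_max g0.
  rewrite ge_max !le_max lexx/=; apply/orP; right.
  apply: le_poweR; [exact: ltW|exact: density_potential_ge0|].
  by apply: le_density_potential.
rewrite ge_max; apply/andP; split.
  by apply: le_trans (F_le_f 1%N x); rewrite /= le_max lexx.
have Pf0 : 0 <= P f x by exact: density_potential_ge0.
(* The limit is taken in [P (F n) x <= f x ^ (1/q)], whose right side is fixed; no continuity of the
   power on extended reals is involved. *)
have PfV : P f x <= f x `^ q^-1.
  rewrite -(cvg_lim _ (PfE x))//; apply: lime_le; first exact: cvgP (PfE x).
  apply: nearW => n.
  rewrite -[leLHS]poweRe1; last exact: density_potential_ge0.
  rewrite -(mulfV (lt0r_neq0 q0)) poweRrM; apply: le_poweR.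
  - by rewrite invr_ge0 ltW.
  - exact: poweR_ge0.
  by apply: le_trans (F_le_f n.+1 x); rewrite /= le_max lexx orbT.
apply: le_trans (le_poweR (ltW q0) Pf0 PfV) _.
by rewrite -poweRrM mulVf ?gt_eqF// poweRe1.
Qed.

End iteration.
End fixpoint.

Section solutions.
Context (R : realType) (T : ptopologicalType).
Hypothesis second_countableT : @second_countable T.
Variables (G : T -> T -> \bar R).
Hypothesis G0 : forall x y, 0 <= G x y.
Hypothesis lscG : lower_semicontinuous (fun p : T * T => G p.1 p.2).
Variables (sigma : {measure set (borelType T) -> \bar R}) (q : R).
Hypotheses (q0 : (0 < q)%R) (q1 : (q < 1)%R).

Local Notation P := (density_potential G sigma).

(** The power [u = f^(1/q)] of the fixed point [f] works: it is positive where [g] is, and finite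
    almost everywhere since [f] is integrable. If [g] is a subsolution, then
    [g <= (P g)^q <= (P f)^q], and the maximum in the equation for [f] is its second term. *)
Lemma strong_type_solution (g : borelType T -> \bar R) :
  strong_type_inequality G sigma q ->
  measurable_fun setT g -> (forall x, 0 <= g x) -> \int[sigma]_x g x < +oo ->
  {ae sigma, forall x, 0 < g x} ->
  exists u : borelType T -> \bar R, [/\ in_Lq sigma q u,
    {ae sigma, forall x, 0 < u x /\ u x < +oo},
    forall x, potential_pow G sigma q u x <= u x &
    (forall x, g x <= P g x `^ q) ->
      forall x, u x = potential_pow G sigma q u x].
Proof.
move=> strong mg g0 goo g_gt0.
have [f [mf f0 foo fE]] :=
  sublinear_iter_fixpoint second_countableT G0 lscG q0 q1 mg g0 goo strong.
have qV : (0 < q^-1)%R by rewrite invr_gt0.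
pose u (x : borelType T) := f x `^ q^-1.
have uq x : u x `^ q = f x by rewrite /u -poweRrM mulVf ?gt_eqF// poweRe1.
have u_pow x : potential_pow G sigma q u x = P f x.
  by apply: eq_integral => y _; rewrite uq.
have u0 x : 0 <= u x by exact: poweR_ge0.
have P0 x : 0 <= P f x by exact: density_potential_ge0.
have PV x : (P f x `^ q) `^ q^-1 = P f x by rewrite -poweRrM mulfV ?gt_eqF// poweRe1.
have gf x : g x <= f x by rewrite fE le_max lexx.
exists u; split.
- split; first exact: (measurableT_comp (measurable_poweR _)).
  apply/(Lnorm_lt_pinfty _ q0); apply: le_lt_trans foo; rewrite le_eqVlt.
  by apply/orP; left; apply/eqP/eq_integral => x _; rewrite gee0_abs.
- have intf : sigma.-integrable setT f.
    apply/integrableP; split => //.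
    by under eq_integral do rewrite gee0_abs//.
  have [N1 [mN1 N10 N1g]] := g_gt0.
  have [N2 [mN2 N20 N2f]] := integrable_ae measurableT intf.
  exists (N1 `|` N2); split; first exact: measurableU.
    by rewrite measureU0.
  move=> x /= nx; have [fx|nfx] := pselect (f x \is a fin_num); last first.
    by right; apply: N2f => /= h; apply: nfx; exact: h.
  left; apply: N1g => /= gx; apply: nx; split.
    by apply: poweR_gt0; exact: lt_le_trans (gf x).
  by apply: poweR_lty; rewrite -ge0_fin_numE.
- move=> x; rewrite u_pow -[leLHS]PV; apply: le_poweR => //.
  + exact: ltW.
  + exact: poweR_ge0.
  + by rewrite [leRHS]fE le_max lexx orbT.
- move=> gP x; rewrite u_pow -[RHS]PV /u; congr (_ `^ _).
  rewrite fE; apply/max_idPr; apply: le_trans (gP x) _.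
  apply: le_poweR; first exact: ltW.
    exact: density_potential_ge0.
  exact: le_density_potential.
Qed.

(** * Integrable weights and subsolutions *)

Section weights.
Variables (e : nat -> set (borelType T)) (c : nat -> R).
Hypotheses (me : forall n, measurable (e n)) (c0 : forall n, (0 <= c n)%R).
Hypothesis c_sum : forall n, (c n)%:E * sigma (e n) <= ((1 / 2) ^+ n)%:E.

Definition weight (x : borelType T) : \bar R :=
  \sum_(0 <= n <oo) (c n * \1_(e n) x)%:E.

Let term_ge0 n x : 0 <= (c n * \1_(e n) x)%:E :> \bar R.
Proof. by rewrite lee_fin mulr_ge0. Qed.

Lemma weight_ge0 x : 0 <= weight x.
Proof. exact: nneseries_ge0. Qed.

Let mterm n : measurable_fun setT (fun x => (c n * \1_(e n) x)%:E : \bar R).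
Proof. by apply/measurable_EFinP; apply: measurable_funM. Qed.

Lemma measurable_weight : measurable_fun setT weight.
Proof. exact: ge0_emeasurable_sum. Qed.

Lemma weight_ge n x : e n x -> (c n)%:E <= weight x.
Proof.
move=> ex; apply: le_trans (nneseries_lim_ge n.+1 (fun k _ _ => term_ge0 k x)).
by rewrite big_nat_recr//= indicE mem_set// mulr1 leeDr// sume_ge0.
Qed.

Lemma integral_weight : \int[sigma]_x weight x < +oo.
Proof.
rewrite integral_nneseries//.
apply: (@le_lt_trans _ _ (\sum_(0 <= n <oo) (1 * (1 / 2) ^+ n)%:E)).
  apply: lee_nneseries => [k _ _|k _]; first exact: integral_ge0.
  under eq_integral do rewrite EFinM.
  rewrite ge0_integralZl_EFin//; last exact/measurable_EFinP.
  by rewrite integral_indic// setIT mul1r.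
apply: le_lt_trans (nneseries_geometric_le _ _) _ => //; last by rewrite ltey.
by rewrite divr_ge0//= ltr_pdivrMr// mul1r ltr1n.
Qed.

Hypothesis c_sub : forall n x, e n x ->
  (c n)%:E <= ((1 / 2) ^+ n.+1)%:E *
              ((c n)%:E * \int[sigma]_(y in e n) G x y) `^ q.

(** Since [weight >= c n] on [e n], [c_sub] bounds the term of index [n] by
    [2^-(n+1) (P weight x)^q], and these fractions add up to 1. *)
Lemma weight_subsolution x : weight x <= P weight x `^ q.
Proof.
have mw := measurable_weight; have w0 := weight_ge0.
have mG : measurable_fun setT (G x : borelType T -> \bar R).
  exact: measurable_kernel_section.
set A := _ `^ q; have A0 : 0 <= A by exact: poweR_ge0.
have termA n : (c n * \1_(e n) x)%:E <= ((1 / 2) ^+ n.+1)%:E * A.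
  rewrite indicE; have [ex|nex] := boolP (x \in e n); last first.
    by rewrite mulr0 mule_ge0// lee_fin exprn_ge0.
  move: ex; rewrite inE mulr1 => ex; apply: le_trans (c_sub ex) _.
  apply: lee_wpmul2l; first by rewrite lee_fin exprn_ge0.
  apply: le_poweR; first exact: ltW.
    by apply: mule_ge0; [rewrite lee_fin|exact: integral_ge0].
  rewrite -ge0_integralZl//; last 2 first.
  - exact: measurable_funTS.
  - by rewrite lee_fin.
  apply: (@le_trans _ _ (\int[sigma]_(y in e n) (G x y * weight y))).
    apply: ge0_le_integral => //.
    - by move=> y _; rewrite mule_ge0 ?lee_fin.
    - by apply: measurable_funeM; exact: measurable_funTS.
    - by apply: measurable_funTS; exact: emeasurable_funM.
    - by move=> y ey; rewrite muleC lee_wpmul2l// weight_ge.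
  apply: ge0_subset_integral => //; first exact: emeasurable_funM.
  by move=> y _; rewrite mule_ge0.
move: A0 termA; case: A => [A|_ _|//]; last exact: leey.
rewrite lee_fin => A0 termA.
apply: (@le_trans _ _ (\sum_(0 <= n <oo) (A / 2 * (1 / 2) ^+ n)%:E)).
  apply: lee_nneseries => // n _; apply: le_trans (termA n) _.
  by rewrite -EFinM lee_fin exprS mulrAC div1r (mulrC A).
apply: le_trans (nneseries_geometric_le _ _) _.
- by rewrite divr_ge0.
- by rewrite divr_ge0//= ltr_pdivrMr// mul1r ltr1n.
rewrite lee_fin (_ : (1 - 1 / 2 = 1 / 2)%R); last by field.
by rewrite div1r invrK divfK.
Qed.

End weights.
End solutions.

(** For [q < 1] the condition [c <= B c^q] reads [c^(1-q) <= B]: it holds for every small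
    [c > 0]. *)
Lemma sublinear_scale (R : realType) (q B w : R) : (q < 1 -> 0 < B -> 0 < w ->
  exists c : R, [/\ 0 < c, c <= w & c <= B * c `^ q])%R.
Proof.
move=> q1 B0 w0; have q1V : (0 < 1 - q)%R by rewrite subr_gt0.
have [c c0 /andP[cw cB]] : exists2 c : R, (0 < c)%R &
    (c <= w)%R && (c <= B `^ (1 - q)^-1)%R.
  exists (Num.min w (B `^ (1 - q)^-1))%R; first by rewrite lt_min w0 powR_gt0.
  by rewrite !ge_min !lexx orbT.
exists c; split => //.
have cE : (c = c `^ (1 - q) * c `^ q)%R.
  by rewrite -powRD ?(lt0r_neq0 c0) ?implybT// subrK powRr1 ?(ltW c0).
rewrite [leLHS]cE; apply: ler_wpM2r; first exact: powR_ge0.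
have : (c `^ (1 - q) <= (B `^ (1 - q)^-1) `^ (1 - q))%R.
  by apply: ge0_ler_powR; rewrite ?nnegrE ?powR_ge0 ?(ltW c0) ?(ltW q1V).
by rewrite -powRrM mulVf ?gt_eqF// powRr1 ?(ltW B0).
Qed.

Section positive_weights.
Context (R : realType) (T : ptopologicalType).
Variables (G : T -> T -> \bar R).
Hypothesis G0 : forall x y, 0 <= G x y.
Variables (sigma : {measure set (borelType T) -> \bar R}) (q : R).
Hypotheses (q0 : (0 < q)%R) (q1 : (q < 1)%R).
Hypothesis mG : forall x, measurable_fun setT (G x : borelType T -> \bar R).
Variable U : set (borelType T).
Hypothesis mU : measurable U.

Lemma positive_weight (w : R) : (0 < w)%R -> sigma U < +oo ->
  exists2 c : R, (0 < c)%R & c%:E * sigma U <= w%:E.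
Proof.
move=> w0 Uoo; have Ufin : sigma U \is a fin_num by rewrite ge0_fin_numE.
have s0 : (0 <= fine (sigma U))%R by rewrite fine_ge0.
exists (w / (1 + fine (sigma U)))%R; first by rewrite divr_gt0// ltr_pwDl.
rewrite -{2}(fineK Ufin) -EFinM lee_fin mulrAC ler_pdivrMr ?ltr_pwDl//.
by rewrite ler_pM2l// lerDr.
Qed.

(** On [U] the integral of [G] is at least [eps sigma(U)], so [sublinear_scale] with constant
    [B (eps sigma(U))^q] yields [c]. *)
Lemma positive_subsolution_weight (w B eps : R) :
  (0 < w)%R -> (0 < B)%R -> (0 < eps)%R -> 0 < sigma U -> sigma U < +oo ->
  (forall x y, U x -> U y -> eps%:E <= G x y) ->
  exists c : R, [/\ (0 < c)%R, c%:E * sigma U <= w%:E &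
    forall x, U x ->
      c%:E <= B%:E * (c%:E * \int[sigma]_(y in U) G x y) `^ q].
Proof.
move=> w0 B0 eps0 U0 Uoo Geps.
have [w' w'0 w'U] := positive_weight w0 Uoo.
have Ufin : sigma U \is a fin_num by rewrite ge0_fin_numE.
pose s := fine (sigma U).
have s0 : (0 < s)%R by rewrite fine_gt0// U0.
have B'0 : (0 < B * (eps * s) `^ q)%R by rewrite mulr_gt0// powR_gt0// mulr_gt0.
have [c [c0 cw cB]] := sublinear_scale q1 B'0 w'0.
exists c; split => // [|x Ux].
  by apply: le_trans w'U; apply: lee_wpmul2r; rewrite ?lee_fin.
apply: (@le_trans _ _ (B%:E * (c%:E * (eps%:E * sigma U)) `^ q)).
  rewrite -(fineK Ufin) -/s -!EFinM lee_fin.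
  have es0 : (0 <= eps * s)%R by rewrite mulr_ge0 ?(ltW eps0) ?(ltW s0).
  by rewrite (mulrC c) powRM ?(ltW c0)// mulrA.
apply: lee_wpmul2l; first by rewrite lee_fin ltW.
apply: le_poweR; first exact: ltW.
  by rewrite !mule_ge0// lee_fin ltW.
apply: lee_wpmul2l; first by rewrite lee_fin ltW.
rewrite -integral_cst//; apply: ge0_le_integral => //.
- by move=> y _; rewrite lee_fin ltW.
- exact: measurable_funTS.
- by move=> y Uy; exact: Geps.
Qed.

End positive_weights.

(** * Existence of supersolutions and solutions *)

Section existence.
Context (R : realType) (T : ptopologicalType).
Hypothesis hausdorffT : hausdorff_space T.
Hypothesis second_countableT : @second_countable T.
Variables (G : T -> T -> \bar R).
Hypothesis G0 : forall x y, 0 <= G x y.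
Hypothesis lscG : lower_semicontinuous (fun p : T * T => G p.1 p.2).
Variables (sigma : {measure set (borelType T) -> \bar R}) (q : R).
Hypotheses (q0 : (0 < q)%R) (q1 : (q < 1)%R).
Hypothesis lfin_sigma : locally_finite sigma.

Lemma half_expr_gt0 n : (0 < (1 / 2) ^+ n :> R)%R.
Proof. by rewrite exprn_gt0// divr_gt0. Qed.

Lemma strong_type_supersolution :
  strong_type_inequality G sigma q -> has_positive_supersolution G sigma q.
Proof.
move=> strong; have [e [eo en]] := second_countable_seq second_countableT.
have me n : measurable (e n : set (borelType T)) by exact: open_measurable_borel.
(* Basic sets of infinite measure get weight 0. Every point still lies in a basic set of finite
   measure, so the weight is positive everywhere. *)
have /choice[c cP] : forall n, exists c : R, [/\ (0 <= c)%R,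
    c%:E * sigma (e n) <= ((1 / 2) ^+ n)%:E & sigma (e n) < +oo -> (0 < c)%R].
  move=> n; have [eoo|neoo] := pselect (sigma (e n) < +oo); last first.
    by exists 0%R; split => //; rewrite mul0e lee_fin ltW// half_expr_gt0.
  have [c c0 ce] := positive_weight (half_expr_gt0 n) eoo.
  by exists c; split => //; exact: ltW.
have c0 n : (0 <= c n)%R by case: (cP n).
have ce n : (c n)%:E * sigma (e n) <= ((1 / 2) ^+ n)%:E by case: (cP n).
have [|u [Lu u_fin u_super _]] := strong_type_solution second_countableT G0 lscG q0 q1
  strong (measurable_weight me c0) (weight_ge0 e c0) (integral_weight me c0 ce).
  apply: aeW => x; have [V Vx Voo] := lfin_sigma x.
  have [n nx nV] := en _ _ (open_nbhs_nbhs Vx).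
  apply: lt_le_trans (weight_ge c0 nx); rewrite lte_fin.
  case: (cP n) => _ _; apply; apply: le_lt_trans Voo.
  by apply: le_measure; rewrite ?inE//; apply: open_measurable_borel; case: Vx.
exists u => //; case: u_fin => N [mN N0 Nu]; exists N; split => // x nx.
by apply: Nu => /= ux; apply: nx.
Qed.

Hypothesis wmpG : weak_maximum_principle G.

(** The Dirac mass at [y] has potential [G (., y)], and its support is within [{y}] because the
    space is Hausdorff. The maximum principle takes only positive bounds, so it is applied with
    [M / h] for arbitrary [M > 0]. *)
Lemma diagonal_eq0 y : G y y = 0 -> forall x, G x y = 0.
Proof.
move=> Gyy0 x; have [h h1 hG] := wmpG.
pose nu : {measure set (borelType T) -> \bar R} := dirac (y : borelType T).
have nuE z : potential G nu z = G z y.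
  rewrite /potential integral_dirac//; last exact: measurable_kernel_section.
  by rewrite diracT mul1e.
have nuT : nu setT < +oo by rewrite /nu /= diracT ltey.
have supp z : measure_support nu z -> z = y.
  move=> suppz; apply: contrapT => zy.
  move: (hausdorffT); rewrite open_hausdorff => /(_ z y (introN eqP zy)).
  move=> [[A B] /= [/set_mem zA /set_mem yB] [oA oB /eqP AB]].
  have := suppz A (conj oA zA); rewrite /nu /= diracE memNset ?ltxx// => Ay.
  by move/seteqP: AB => [/(_ y (conj Ay yB))].
have h0 : (0 < h)%R by exact: lt_le_trans h1.
apply: le_anti; rewrite G0 andbT; apply/lee_addgt0Pr => M M0; rewrite add0e.
have Mh0 : (0 < M / h)%R by rewrite divr_gt0.
rewrite -nuE (_ : M = h * (M / h))%R; last by rewrite mulrC divfK ?gt_eqF.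
apply: hG => // [|z /supp ->]; first exact: finite_locally_finite.
by rewrite nuE Gyy0 lee_fin ltW.
Qed.

Lemma diagonal_null : ~ degenerate G sigma ->
  measurable [set y : borelType T | G y y = 0] /\
  sigma [set y | G y y = 0] = 0.
Proof.
move=> ndeg.
have mdiag : measurable [set y : borelType T | G y y = 0].
  rewrite -[X in measurable X]setTI; apply: measurable_eqe => //.
  have mpair : measurable_fun setT (fun y : borelType T => (y, y)).
    exact: measurable_fun_pair.
  exact: (measurableT_comp (measurable_kernel second_countableT lscG) mpair).
split => //; apply/eqP; rewrite -measure_le0 leNgt; apply/negP => pos.
apply: ndeg; exists [set y | G y y = 0]; split => // y /= Gyy.
by apply: aeW => x; exact: diagonal_eq0.
Qed.

Lemma strong_type_positive_solution : ~ degenerate G sigma ->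
  strong_type_inequality G sigma q -> has_positive_solution G sigma q.
Proof.
move=> ndeg strong; have [mdiag diag0] := diagonal_null ndeg.
have [e [eo en]] := second_countable_seq second_countableT.
have me n : measurable (e n : set (borelType T)) by exact: open_measurable_borel.
have mG x : measurable_fun setT (G x : borelType T -> \bar R).
  exact: measurable_kernel_section.
(* The weight is 0, for which the inequalities are trivial, unless [e n] has positive finite measure
   and [G] is bounded below on its square. *)
have /choice[c cP] : forall n, exists c : R, [/\ (0 <= c)%R,
    c%:E * sigma (e n) <= ((1 / 2) ^+ n)%:E,
    forall x, e n x -> c%:E <= ((1 / 2) ^+ n.+1)%:E *
       (c%:E * \int[sigma]_(y in e n) G x y) `^ q &
    0 < sigma (e n) -> sigma (e n) < +oo ->
    (exists2 eps : R, (0 < eps)%R &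
      forall x y, e n x -> e n y -> eps%:E <= G x y) -> (0 < c)%R].
  move=> n; have [[e0 eoo [eps eps0 Geps]]|ngood] := pselect
    [/\ 0 < sigma (e n), sigma (e n) < +oo & exists2 eps : R, (0 < eps)%R &
      forall x y, e n x -> e n y -> eps%:E <= G x y]; last first.
    exists 0%R; split => //.
    - by rewrite mul0e lee_fin ltW// half_expr_gt0.
    - by move=> x _; rewrite mule_ge0 ?poweR_ge0// lee_fin ltW// half_expr_gt0.
    - by move=> ? ? ?; exfalso; apply: ngood.
  have [c [c0 cw cG]] := positive_subsolution_weight q0 q1 mG (me n)
    (half_expr_gt0 n) (half_expr_gt0 n.+1) eps0 e0 eoo Geps.
  by exists c; split => //; exact: ltW.
have c0 n : (0 <= c n)%R by case: (cP n).
have ce n : (c n)%:E * sigma (e n) <= ((1 / 2) ^+ n)%:E by case: (cP n).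
have c_sub n x : e n x -> (c n)%:E <= ((1 / 2) ^+ n.+1)%:E *
    ((c n)%:E * \int[sigma]_(y in e n) G x y) `^ q by case: (cP n) => _ _ + _; apply.
(* The union of the null basic sets is null; outside it every basic neighbourhood has positive
   measure. *)
pose Z n : set (borelType T) := if sigma (e n) == 0 then e n else set0.
have mZ n : measurable (Z n) by rewrite /Z; case: ifP.
have Z0 n : sigma (Z n) = 0 by rewrite /Z; case: ifPn => [/eqP|_]; rewrite ?measure0.
have [|u [Lu u_fin _ u_sol]] := strong_type_solution second_countableT G0 lscG q0 q1
  strong (measurable_weight me c0) (weight_ge0 e c0) (integral_weight me c0 ce).
  exists ([set y | G y y = 0] `|` \bigcup_n Z n); split.
  - by apply: measurableU => //; exact: bigcup_measurable.
  - rewrite measureU0//; first exact: bigcup_measurable.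
    apply: measure_negligible; first exact: bigcup_measurable.
    by apply: negligible_bigcup => n; exists (Z n); split => //; exact: Z0.
  move=> x; apply: contra_notP => /not_orP[/= Gxx nZ].
  have {}Gxx : 0 < G x x by rewrite lt_neqAle eq_sym G0 andbT; exact/eqP.
  (* Lower semicontinuity at [(x, x)] gives [G > eps] on a product [A x B]; a basic set inside both
     factors and inside a set of finite measure has positive weight. *)
  have [eps eps0 epsG] := ereal_dense (lexx 0) Gxx.
  have [W [[A B] /= [xA xB] AB] WG] := lscG (x := (x, x)) epsG.
  have [V Vx Voo] := lfin_sigma x.
  have [n nx nABV] := en _ _ (filterI (filterI xA xB) (open_nbhs_nbhs Vx)).
  apply: lt_le_trans (weight_ge c0 nx); rewrite lte_fin.
  case: (cP n) => _ _ _; apply.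
  - rewrite lt_neqAle eq_sym measure_ge0 andbT; apply/negP => en0.
    by apply: nZ; exists n => //; rewrite /Z en0.
  - apply: le_lt_trans Voo; apply: le_measure; rewrite ?inE//.
      by apply: open_measurable_borel; case: Vx.
    by move=> z /nABV[].
  exists eps; first by rewrite -lte_fin.
  move=> y z /nABV[[yA _] _] /nABV[[_ zB] _].
  by apply/ltW/(WG (y, z))/AB; split.
exists u => //; case: u_fin => N [mN N0 Nu]; exists N; split => // x nx.
apply: Nu => /= ux; apply: nx; split => //; apply: u_sol => y.
exact: (weight_subsolution G0 lscG q0 me c0 c_sub).
Qed.
End existence.

Theorem theorem1p1 (R : realType) (T : ptopologicalType)
    (hausdorffT : hausdorff_space T)
    (locally_compactT : locally_compact [set: T])
    (second_countableT : @second_countable T)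
    (sigma : {measure set (borelType T) -> \bar R})
    (locally_finite_sigma : locally_finite sigma)
    (q : R) (q_gt0 : (0 < q)%R) (q_lt1 : (q < 1)%R)
    (G : T -> T -> \bar R)
    (G_ge0 : forall x y, 0 <= G x y)
    (lscG : lower_semicontinuous (fun p : T * T => G p.1 p.2))
    (qsymG : quasi_symmetric G)
    (wmpG : weak_maximum_principle G) :
  (strong_type_inequality G sigma q <-> has_positive_supersolution G sigma q)
  /\
  (~ degenerate G sigma ->
     (strong_type_inequality G sigma q <-> has_positive_supersolution G sigma q)
     /\
     (has_positive_supersolution G sigma q <-> has_positive_solution G sigma q)).
Proof.
have super_strong := supersolution_strong_type second_countableT G_ge0 lscG
  (sigma := sigma) q_gt0 q_lt1 qsymG wmpG.
have strong_super := strong_type_supersolution second_countableT G_ge0 lscG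
  q_gt0 q_lt1 locally_finite_sigma.
split; first by split.
move=> ndeg; split; first by split.
split=> [/super_strong|[u Lu [N [mN N0 Nu]]]].
  exact: strong_type_positive_solution.
exists u => //; exists N; split => // x nx; apply: Nu => /= -[ux u0].
by apply: nx; split=> //; rewrite -ux lexx.
Qed.
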